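(* Let $\mathbb{V}=(V_1,\dots,V_n)$ be a completely non-unitary $n$-tuple of commuting isometries on a Hilbert space. If $\operatorname{Ann}(\mathbb{V})$ is a prime ideal and $Z(\operatorname{Ann}(\mathbb{V}))$ has dimension $1$, then there exists an $s\in\{1,\dots,n\}$ such that, after a permutation of coordinates (the same permutation being applied to the entries of $\mathbb{V}$ and to the coordinates of $\mathbb{C}^n$), (1) $\mathbb{V}=(V_1,\dots,V_s,\lambda_{s+1}I,\dots,\lambda_n I)$ where $V_1,\dots,V_s$ are shifts and $\lambda_{s+1},\dots,\lambda_n$ are scalars of absolute value $1$; and (2) $Z(\operatorname{Ann}(\mathbb{V}))=\mathcal{W}\times\{(\lambda_{s+1},\dots,\lambda_n)\}$ for some $1$-dimensional distinguished variety $\mathcal{W}\subseteq \mathbb{C}^s$.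
   Context: Hilbert spaces are complex. For an $n$-tuple $\mathbb{V}$ of commuting isometries, $\operatorname{Ann}(\mathbb{V})=\{p\in\mathbb{C}[X_1,\dots,X_n]:p(V_1,\dots,V_n)=0\}$. $\mathbb{V}$ is completely non-unitary if there is no non-zero closed subspace $\mathcal{K}$, reducing for every $V_i$, such that $V_i|\mathcal{K}$ is unitary for every $i$. For a set $S$ of polynomials, $Z(S)\subseteq\mathbb{C}^n$ is the common zero set, and dimension is that of a complex algebraic variety. An operator $V$ on $\mathcal{H}$ is a shift if it is an isometry with $\bigcap_{j=0}^\infty V^j\mathcal{H}=\{0\}$. An algebraic variety $\mathcal{W}\subseteq\mathbb{C}^k$ is a distinguished variety if $\mathcal{W}\subseteq\mathbb{D}^k\cup\mathbb{T}^k\cup\mathbb{E}^k$, where $\mathbb{D}$ is the open unit disc, $\mathbb{T}$ the unit circle, and $\mathbb{E}$ the exterior of the closed unit disc in $\mathbb{C}$. *)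

(* Defs.v *)
From HB Require Import structures.
From mathcomp Require Import all_boot all_order all_algebra all_fingroup.
From mathcomp Require Import ring_quotient complex sesquilinear.
(* The notations of mpoly clash with those of MathComp-Analysis and are not
   imported: mpoly n R is {mpoly R[n]} and meval v p is p.@[v]. *)
From mathcomp Require Import -(notations) mpoly.
From mathcomp Require Import boolp classical_sets reals topology normedtype.
Import numFieldNormedType.Exports.

Set Implicit Arguments.
Unset Strict Implicit.
Unset Printing Implicit Defensive.

Import Order.TTheory GRing.Theory Num.Theory Num.Def.

Local Open Scope classical_set_scope.
Local Open Scope ring_scope.
Local Open Scope complex_scope.

(* idealr_closed includes properness of the ideal. *)
Definition prime_ideal (A : comNzRingType) (I : set A) : Prop :=
  idealr_closed [in I] /\ prime_idealr_closed [in I].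

Section Operators.
Variables (R : realType) (H : completeNormedModType R[i]).

Definition isometric (T : {linear H -> H}) : Prop :=
  forall x : H, `|T x| = `|x|.

Definition is_shift (T : {linear H -> H}) : Prop :=
  isometric T /\ \bigcap_j range (iter j T) = [set 0].

Definition commuting_isometries (n : nat) (V : 'I_n -> {linear H -> H}) : Prop :=
  (forall i, isometric (V i)) /\ (forall i j x, V i (V j x) = V j (V i x)).

(* For a commuting tuple the order of the factors is irrelevant. *)
Definition monomial_op (n : nat) (V : 'I_n -> {linear H -> H})
    (m : multinom n) : H -> H :=
  \big[comp/id]_(i < n) iter (m i) (V i).

Definition mpoly_op (n : nat) (V : 'I_n -> {linear H -> H})
    (p : mpoly n R[i]) (x : H) : H :=
  \sum_(m <- msupp p) mcoeff m p *: monomial_op V m x.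

Definition Ann (n : nat) (V : 'I_n -> {linear H -> H}) :
    set (mpoly n R[i]) :=
  [set p | forall x, mpoly_op V p x = 0].

Variable dot : {dot H for (@conjC R[i])}.

Definition orthocomplement (K : set H) : set H :=
  [set x | forall y, K y -> dot x y = 0].

Definition reducing (T : {linear H -> H}) (K : set H) : Prop :=
  T @` K `<=` K /\ T @` orthocomplement K `<=` orthocomplement K.

Definition unitary_on (T : {linear H -> H}) (K : set H) : Prop :=
  T @` K = K /\ (forall x y, K x -> K y -> dot (T x) (T y) = dot x y).

Definition completely_non_unitary (n : nat) (V : 'I_n -> {linear H -> H}) :
    Prop :=
  ~ exists K : set H,
      [/\ closed K, GRing.submod_closed [in K], K <> [set 0],
          forall i, reducing (V i) K & forall i, unitary_on (V i) K].

End Operators.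

Section Varieties.
Variable R : realType.

Definition zero_set (n : nat) (S : set (mpoly n R[i])) :
    set 'rV[R[i]]_n :=
  [set z | forall p, S p -> meval (z 0) p = 0].

Definition algebraic_variety (n : nat) (X : set 'rV[R[i]]_n) : Prop :=
  exists S, X = zero_set S.

Definition irreducible_variety (n : nat) (X : set 'rV[R[i]]_n) : Prop :=
  [/\ algebraic_variety X, X !=set0 &
      forall A B, algebraic_variety A -> algebraic_variety B ->
        X = A `|` B -> X = A \/ X = B].

(* Y 0 `<` Y 1 `<` ... `<` Y k, all inside X *)
Definition has_irreducible_chain (n : nat) (X : set 'rV[R[i]]_n) (k : nat) :
    Prop :=
  exists Y : nat -> set 'rV[R[i]]_n,
    (forall j, (j <= k)%N -> irreducible_variety (Y j) /\ Y j `<=` X) /\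
    (forall j, (j < k)%N -> Y j `<` Y j.+1).

(* Krull dimension of the Zariski topology *)
Definition variety_dimension (n : nat) (X : set 'rV[R[i]]_n) (d : nat) : Prop :=
  has_irreducible_chain X d /\
  (forall k, has_irreducible_chain X k -> (k <= d)%N).

Definition distinguished_variety (n : nat) (W : set 'rV[R[i]]_n) : Prop :=
  algebraic_variety W /\
  W `<=` [set z | forall i, `|z 0 i| < 1] `|`
         [set z | forall i, `|z 0 i| = 1] `|`
         [set z | forall i, 1 < `|z 0 i|].

End Varieties.

(* Main.v *)
Require Import Defs.
From HB Require Import structures.
From mathcomp Require Import all_boot all_order all_algebra all_fingroup.
From mathcomp Require Import ring_quotient complex sesquilinear.
From mathcomp Require Import -(notations) mpoly.
From mathcomp Require Import boolp classical_sets reals topology normedtype.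
From mathcomp Require Import cardinality sequences ssrcomplements.
From mathcomp Require Import ring lra.
Import numFieldNormedType.Exports.
Set Implicit Arguments.
Unset Strict Implicit.
Unset Printing Implicit Defensive.
Import Order.TTheory GRing.Theory Num.Theory Num.Def.
Local Open Scope classical_set_scope.
Local Open Scope ring_scope.
Local Open Scope complex_scope.

(** The two hypotheses on the annihilator are used through one elimination
    principle, [curve_elimination]: if [X_i] is not constant modulo [Ann V] and
    [f] is not in [Ann V], then some non-zero polynomial in [X_i] alone
    belongs to [Ann V + (f)].  Otherwise a prime ideal between would give a chain
    of irreducible varieties of length two; that prime ideals have enough zeros
    for this is [prime_nullstellensatz], proved by counting since the field is
    uncountable.

    Call [V i] scalar when [X_i - l] is in [Ann V] for some [l]; then
    [V i = l I] with [|l| = 1].  A non-scalar [V i] has no eigenvector: by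
    elimination modulo [X_i - l] the whole tuple would be unitary on the
    eigenspace ([no_eigenvector]).  It follows that [f(V)] is injective for
    every [f] outside [Ann V] ([op_injective]).  Elimination modulo [X_j] then
    shows that the tuple is unitary on the intersection of the ranges of the
    powers of [V i], which must vanish: [V i] is a shift ([nonscalar_shift]).
    Some coordinate is a shift, for a tuple of unimodular scalars is unitary.

    It remains to see that at a zero [z] of [Ann V] the coordinates [z_i] and
    [z_j] of two shifts lie on the same side of the unit circle
    ([shift_pair_toral]).  In the cyclic subspace [K] of a vector, the wandering
    spaces [E] of [V i] and [F] of [V j] are finite-dimensional, because all
    coordinates are algebraic modulo [X_i], and modulo [X_j].  The relations
    [V_j e + f = a + V_i c], with [e, a] in [E] and [f, c] in [F], define a unitary
    [(e, f) |-> (a, c)] of [E + F] and a determinantal polynomial in [X_i] and [X_j]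
    that belongs to [Ann V].  At a zero of this determinant there are non-zero
    [e] in [E] and [g] in [F] with
    [(1 - |z_j|^2) |e|^2 = (1 - |z_i|^2) |g|^2].

    Finally the zero set of [Ann V] is the graph of the constants [l] over its
    projection on the shift coordinates, and this projection is an isomorphism
    of varieties, so it preserves the dimension ([cylinder_structure]). *)

(** * Prime ideals avoiding a multiplicative set *)
Section PrimeAvoidance.
Variable A : comNzRingType.
Implicit Types (I J S : set A).

Definition is_ideal I : Prop :=
  [/\ I 0, forall x y, I x -> I y -> I (x + y) & forall a x, I x -> I (a * x)].

Definition is_prime I : Prop :=
  [/\ is_ideal I, ~ I 1 & forall x y, I (x * y) -> I x \/ I y].

(** The ideal generated by [f] over [I], when [I] is an ideal. *)
Definition adjoin I (f : A) : set A := [set x | exists h, I (x - h * f)].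

Lemma adjoin_sub I f : I `<=` adjoin I f.
Proof. by move=> x Ix; exists 0; rewrite mul0r subr0. Qed.

Lemma adjoin_self I f : is_ideal I -> adjoin I f f.
Proof. by case=> I0 _ _; exists 1; rewrite mul1r subrr. Qed.

Lemma adjoin_ideal I f : is_ideal I -> is_ideal (adjoin I f).
Proof.
case=> I0 ID IM; split.
- by exists 0; rewrite mul0r subr0.
- move=> x y [h hx] [k ky]; exists (h + k).
  by rewrite mulrDl opprD addrACA; exact: ID.
- move=> a x [h hx]; exists (a * h).
  by rewrite -mulrA -mulrBr; exact: IM.
Qed.

Lemma is_ideal_opp I x : is_ideal I -> I x -> I (- x).
Proof. by case=> _ _ IM Ix; rewrite -mulN1r; exact: IM. Qed.

Lemma is_ideal_sub I x y : is_ideal I -> I x -> I y -> I (x - y).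
Proof. by move=> hI Ix Iy; case: (hI) => _ ID _; apply: ID => //; exact: is_ideal_opp. Qed.

Lemma is_ideal_sum I (T : Type) (r : seq T) (P : pred T) (F : T -> A) :
  is_ideal I -> (forall t, P t -> I (F t)) -> I (\sum_(t <- r | P t) F t).
Proof. by case=> I0 ID _ h; apply: big_ind. Qed.

Lemma is_prime_exp I x k : is_prime I -> I (x ^+ k) -> I x.
Proof.
case=> _ I1 IP; elim: k => [|k IHk]; first by rewrite expr0.
by rewrite exprS => /IP[].
Qed.

Lemma is_prime_prod I (T : Type) (r : seq T) (F : T -> A) :
  is_prime I -> I (\prod_(t <- r) F t) -> exists t, I (F t).
Proof.
case=> _ I1 IP; elim: r => [|t r IHr]; first by rewrite big_nil.
by rewrite big_cons => /IP[It|/IHr//]; exists t.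
Qed.

(** Krull's argument.  An ideal maximal among those containing [I] and disjoint
    from [S] is prime: if [x] and [y] lie outside it, adjoining either of them
    produces an element of [S], and so does the product.  The maximality is kept
    in the conclusion because the Nullstellensatz below uses it. *)
Lemma prime_avoiding I S : is_ideal I -> S 1 ->
  (forall x y, S x -> S y -> S (x * y)) -> (forall x, I x -> ~ S x) ->
  exists P, [/\ is_prime P, I `<=` P, forall x, P x -> ~ S x &
    forall x, ~ P x -> exists2 s, S s & adjoin P x s].
Proof.
move=> Iid S1 SM IS.
(* The union of an empty chain is empty and not an ideal, so the condition is
   imposed on non-empty sets only. *)
pose good J := [/\ is_ideal J, I `<=` J & forall x, J x -> ~ S x].
have [F FF Ftot|P [Pgood Pmax]] :=
    @Zorn_bigcup A [set J | J !=set0 -> good J].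
  move=> [x0 [J0 FJ0 J0x0]].
  have g0 : good J0 by apply: FF => //; exists x0.
  have gF J x : F J -> J x -> good J by move=> FJ Jx; apply: FF => //; exists x.
  have [[J00 _ _] IJ0 _] := g0.
  split; first split.
  - by exists J0.
  - move=> x y [J FJ Jx] [J' FJ' J'y].
    have [[_ D _] _ _] := gF _ _ FJ Jx; have [[_ D' _] _ _] := gF _ _ FJ' J'y.
    have [s|s] := Ftot _ _ FJ FJ'.
      by exists J' => //; apply: D' => //; apply: s.
    by exists J => //; apply: D => //; apply: s.
  - move=> a x [J FJ Jx]; exists J => //.
    by have [[_ _ M] _ _] := gF _ _ FJ Jx; apply: M.
  - by move=> x Ix; exists J0 => //; apply: IJ0.
  - by move=> x [J FJ Jx]; have [_ _] := gF _ _ FJ Jx; apply.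
have gI : good I by split.
have [I0 _ _] := Iid.
have Pne : P !=set0.
  apply: contrapT => Pe; apply: (Pmax I) => //; split.
    by move=> x Px; exfalso; apply: Pe; exists x.
  by move=> /(_ _ I0) P0; apply: Pe; exists 0.
have [Pid IP PS] := Pgood Pne.
have maxP x : ~ P x -> exists2 s, S s & adjoin P x s.
  move=> Px; apply: contrapT => hS.
  apply: (Pmax (adjoin P x)).
    split; first exact: adjoin_sub.
    by move=> /(_ _ (adjoin_self x Pid)).
  move=> _; split; first exact: adjoin_ideal.
    by move=> y Iy; apply: adjoin_sub => //; apply: IP.
  by move=> s Ps Ss; apply: hS; exists s.
exists P; split => //; split => //; first by move=> /PS.
move=> x y Pxy; apply: contrapT => /not_orP[/maxP[s Ss [h Ph]] /maxP[t St [k Pk]]].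
apply: (PS (s * t)); last exact: SM.
have [_ PD PM] := Pid.
have -> : s * t = t * (s - h * x) + h * x * (t - k * y) + h * k * (x * y).
  by rewrite !mulrBr [t * s]mulrC [t * (h * x)]mulrC !addrA subrK mulrACA subrK.
by apply: (PD); [apply: (PD)|]; apply: PM.
Qed.

End PrimeAvoidance.

(** * The Nullstellensatz for prime ideals over an uncountable field *)

(** Otherwise the line would be a countable union of points, each closed with
    dense complement, against Baire's theorem. *)
Lemma uncountable_real (R : realType) : ~ countable [set: R].
Proof.
move=> /countable_injP[f finj].
have sub1 (m : nat) : is_subset1 (f @^-1` [set m]).
  by move=> x y fx fy; apply: finj; rewrite ?inE//= fx fy.
pose F (m : nat) : set R := ~` (f @^-1` [set m]).
have odF m : open (F m) /\ dense (F m).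
  split.
    apply: closed_openC.
    apply: (accessible_finite_set_closed.1 (hausdorff_accessible (@Rhausdorff R))).
    have [[x fx]|nx] := pselect (exists x, f x = m).
      suff -> : f @^-1` [set m] = [set x] by exact: finite_set1.
      by apply/seteqP; split=> y /= => [fy|->//]; exact: sub1 fy fx.
    suff -> : f @^-1` [set m] = set0 by exact: finite_set0.
    by apply/seteqP; split=> y //= fy; apply: nx; exists y.
  move=> D [x Dx] oD; apply: contrapT => hD.
  have Dsub y : D y -> f y = m.
    by move=> Dy; apply: contrapT => fy; apply: hD; exists y.
  have /nbhs_ballP[e /= e0 he] : nbhs x D by apply: open_nbhs_nbhs.
  have Dx' : D (x + e / 2).
    apply: he; rewrite /ball/= opprD addrA subrr sub0r normrN gtr0_norm ?divr_gt0//.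
    by rewrite ltr_pdivrMr// mulr_natr mulr2n ltrDl.
  have /eqP := sub1 m _ _ (Dsub _ Dx) (Dsub _ Dx').
  by rewrite addrC -subr_eq subrr eq_sym mulf_eq0 invr_eq0 pnatr_eq0 orbF gt_eqF.
have [||x [_ hx]] := Baire odF (O := [set: R]); [by exists 0|exact: openT|].
by have := hx (f x) I; apply.
Qed.

(** The only consequence of uncountability used below: any countable labelling
    of the complex numbers repeats some label infinitely often. *)
Lemma infinite_fiber (R : realType) (g : R[i] -> nat) :
  exists m, infinite_set (g @^-1` [set m]).
Proof.
apply: contrapT => /forallNP hfin; apply: (@uncountable_real R).
have -> : [set: R] = \bigcup_m ((fun x : R => g x%:C) @^-1` [set m]).
  by apply/seteqP; split=> x // _; exists (g x%:C).
apply: bigcup_countable => // m _; apply: finite_set_countable.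
have := hfin m; rewrite not_notE => fm.
apply: (sub_finite_set _ (finite_image (@complex.Re R) fm)) => x /= gx.
by exists x%:C.
Qed.

(** Polynomials of bounded degree form a finite-dimensional space, so any
    sufficiently large family of them satisfies a linear relation. *)
Lemma bounded_degree_dependence n (C : fieldType) (N d : nat)
    (h : 'I_d -> mpoly n C) :
  (forall a, mmeasure mdeg (h a) <= N)%N -> (#|{: bmultinom n N}| < d)%N ->
  exists c : 'I_d -> C, (exists a, c a != 0) /\ \sum_a c a *: h a = 0.
Proof.
move=> hN cardN.
pose M := \matrix_(a < d, b < #|{: bmultinom n N}|)
   mcoeff (bmnm (enum_val b)) (h a).
have /negP : ~ (kermx M == 0).
  rewrite -mxrank_eq0 mxrank_ker subn_eq0 => /leq_trans /(_ (rank_leq_col M)).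
  by rewrite leqNgt cardN.
move/rowV0Pn => [c /sub_kermxP cM c0]; exists (fun a => c 0 a); split.
  by apply/existsP; move: c0; apply: contraR => /existsPn c0; apply/eqP/rowP => a;
    rewrite mxE; apply/eqP; have := c0 a; rewrite negbK.
apply/mpolyP => m; rewrite raddf_sum mcoeff0 /=.
have [mN|mN] := ltnP (mdeg m) N; last first.
  apply: big1 => a _; rewrite mcoeffZ [X in _ * X](_ : _ = 0) ?mulr0//.
  apply/eqP; rewrite mcoeff_eq0; apply: msize_mdeg_ge.
  by apply: leq_trans (hN a) mN.
have /rowP/(_ (enum_rank (BMultinom mN))) := cM.
rewrite !mxE => cM0; rewrite -[RHS]cM0; apply: eq_bigr => a _.
by rewrite mcoeffZ mxE enum_rankK.
Qed.

Lemma mpoly_alg_ind n (C : comNzRingType) (P : mpoly n C -> Prop) :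
  (forall c, P c%:A) -> (forall i, P (mpolyX C (mnm1 i))) ->
  (forall p q, P p -> P q -> P (p + q)) -> (forall p q, P p -> P q -> P (p * q)) ->
  forall p, P p.
Proof.
move=> PC PX PD PM; elim/mpolyind => [|c m p _ _ Pp].
  by rewrite -(scale0r 1); exact: PC.
apply: (PD) => //; rewrite -mulr_algl; apply: (PM) => //.
have P1 : P 1 by rewrite -[1]scale1r; exact: PC.
rewrite mpolyXE_id; apply: (big_ind P) => [//|x y Px Py|i _]; first exact: PM.
by elim: (m i) => [|k IHk]; rewrite ?expr0// exprS; exact: PM.
Qed.

Section Nullstellensatz.
Variables (R : realType) (n : nat).
Local Notation C := R[i].
Local Notation polyn := (mpoly n C).
Local Notation mX i := (mpolyX C (mnm1 i) : polyn).

(** The polynomial in [a] splits into linear factors, as the field is closed. *)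
Lemma prime_root (P : set polyn) (a : polyn) (r : {poly C}) :
  is_prime P -> r != 0 -> P (horner_alg a r) -> exists l : C, P (a - l%:A).
Proof.
move=> Pp r0; have [Pid P1 PP] := Pp.
have [s] := closed_field_poly_normal r.
move: (lead_coef r) (lead_coef_eq0 r) => c c0 ->; rewrite linearZ /= => /PP[|].
  move=> Pc; exfalso; apply: P1; have [_ _ PM] := Pid.
  have /(PM c^-1%:A) := Pc.
  by rewrite mulr_algl scalerA mulVf ?scale1r// c0.
rewrite rmorph_prod /= => /(is_prime_prod Pp)[l].
by rewrite rmorphB /= horner_algX horner_algC; exists l.
Qed.

(** The hypothesis says that the quotient by [Q], localized at [f], is a field
    [K].  If no [a - l] were in [Q], every [a - l] would be invertible in [K],
    that is [f ^+ k = h * (a - l)] modulo [Q] for some [k] and [h] depending on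
    [l].  For infinitely many [l] the exponent [k] and the degree of [h] agree, so
    finitely many of these [h] are linearly dependent; clearing denominators
    in the relation between the [1 / (a - l)] gives a non-zero polynomial in [a]
    belonging to [Q], hence a root of it. *)
Lemma residue_coordinate (Q : set polyn) (f a : polyn) :
  is_prime Q -> ~ Q f ->
  (forall x, ~ Q x -> exists k, adjoin Q x (f ^+ k)) ->
  exists l : C, Q (a - l%:A).
Proof.
move=> Qp Qf Qmax; have [Qid Q1 QP] := Qp; apply: contrapT => /forallNP noroot.
have /choice[w hw] l : exists kh : nat * polyn, Q (f ^+ kh.1 - kh.2 * (a - l%:A)).
  by have [k [h hh]] := Qmax _ (noroot l); exists (k, h).
pose g l := pickle ((w l).1, mmeasure mdeg (w l).2).
have [m minf] := infinite_fiber g.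
have [N hN] : exists N, forall l, g l = m -> (mmeasure mdeg (w l).2 <= N)%N.
  case E : (@unpickle (nat * nat)%type m) => [[k N]|].
    exists N => l gl; move: E; rewrite -gl pickleK => -[_ ->]; exact: leqnn.
  by exists 0%N => l gl; move: E; rewrite -gl pickleK.
have [k hk] : exists k, forall l, g l = m -> (w l).1 = k.
  case E : (@unpickle (nat * nat)%type m) => [[k N']|].
    by exists k => l gl; move: E; rewrite -gl pickleK => -[].
  by exists 0%N => l gl; move: E; rewrite -gl pickleK.
have [B Bm Bsize] := infinite_set_fset (#|{: bmultinom n N}|.+1) minf.
set s := finmap.enum_fset B in Bsize *.
have sm l : l \in s -> g l = m by move=> ls; apply: Bm.
have us : uniq s by exact: finmap.fset_uniq.
pose lam (b : 'I_(size s)) := nth 0 s b.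
have lam_m b : g (lam b) = m by apply: sm; exact: mem_nth.
have [c [[b0 cb0] hc]] := bounded_degree_dependence
   (h := fun b => (w (lam b)).2) (fun b => hN _ (lam_m b)) Bsize.
(* The numerator of the sum of the partial fractions c_b / (a - lam_b); it does
   not vanish at lam_b0 because c_b0 is non-zero. *)
pose r : {poly C} := \sum_b c b *: \prod_(b' | b' != b) ('X - (lam b')%:P).
have rb0 : r.[lam b0] != 0.
  rewrite horner_sum (bigD1 b0)//= [X in _ + X]big1 ?addr0; last first.
    move=> b bb0; rewrite hornerZ horner_prod (bigD1 b0) 1?eq_sym//=.
  by rewrite hornerXsubC subrr mul0r mulr0.
  rewrite hornerZ mulf_eq0 negb_or cb0 horner_prod; apply/prodf_neq0 => b bb0.
  by rewrite hornerXsubC subr_eq0 (nth_uniq 0)// eq_sym.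
have r0 : r != 0 by apply: contraNneq rb0 => ->; rewrite horner0.
have : Q (f ^+ k * horner_alg a r).
  pose G b := horner_alg a (\prod_(b' | b' != b) ('X - (lam b')%:P)).
  have -> : f ^+ k * horner_alg a r = \sum_b c b *:
      ((f ^+ k - (w (lam b)).2 * (a - (lam b)%:A)) * G b) +
      (\sum_b c b *: (w (lam b)).2) * \prod_b (a - (lam b)%:A).
    rewrite mulr_suml -big_split /= linear_sum /= mulr_sumr.
    apply: eq_bigr => b _; rewrite linearZ /= mulr_algl -scalerAr -scalerAl -scalerDr.
    congr (_ *: _); rewrite mulrBl -/(G b).
    suff -> : \prod_b (a - (lam b)%:A) = (a - (lam b)%:A) * G b.
      by rewrite mulrA subrK.
    rewrite (bigD1 b)//= /G rmorph_prod /=; congr (_ * _).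
    by apply: eq_bigr => b' _; rewrite rmorphB /= horner_algX horner_algC.
  rewrite hc mul0r addr0; apply: is_ideal_sum => // b _.
  have [_ _ QM] := Qid. rewrite -[c b *: _]mulr_algl [_ * G b]mulrC; do 2!apply: (QM).
  by have := hw (lam b); rewrite hk.
case/QP => [/(is_prime_exp Qp)//|/(prime_root Qp r0)[l]]; exact: noroot.
Qed.

(** A prime ideal maximal among those containing [P] and avoiding the powers of
    [f] has all its residue coordinates in the base field: they are a point. *)
Lemma prime_nullstellensatz (P : set polyn) (f : polyn) :
  is_prime P -> ~ P f -> exists2 z : 'rV[C]_n, zero_set P z & meval (z 0) f != 0.
Proof.
move=> Pp Pf; have [Pid P1 PP] := Pp.
have [||x Px [k xk]|Q [Qp PQ QS Qmax]] :=
  @prime_avoiding _ P [set x | exists k, x = f ^+ k] Pid.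
- by exists 0%N; rewrite expr0.
- by move=> _ _ [k ->] [l ->]; exists (k + l)%N; rewrite exprD.
- by apply: Pf; apply: (is_prime_exp Pp (k := k)); rewrite -xk.
have Qf : ~ Q f by move=> /QS; apply; exists 1%N; rewrite expr1.
have Qmax' x : ~ Q x -> exists k, adjoin Q x (f ^+ k).
  by move=> /Qmax[_ [k ->]]; exists k.
have [Qid Q1 _] := Qp; have [Q0 QD QM] := Qid.
have /choice[z hz] i := residue_coordinate (mX i) Qp Qf Qmax'.
have evz p : Q (p - (meval z p)%:A).
  elim/mpoly_alg_ind: p => [c|i|p q hp hq|p q hp hq].
  - by rewrite mevalZ meval1 mulr1 subrr.
  - by rewrite mevalXU.
  - by rewrite mevalD scalerDl opprD addrACA; apply: (QD).
  - have -> : p * q - (meval z (p * q))%:A =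
        q * (p - (meval z p)%:A) + (meval z p)%:A * (q - (meval z q)%:A).
      rewrite mevalM !mulrBr [q * p]mulrC [q * _%:A]mulrC addrA subrK.
      by rewrite !mulr_algl scalerA.
    by apply: (QD); apply: (QM).
have evrow p : meval ((\row_i z i) 0) p = meval z p.
  by apply: meval_eq => i; rewrite mxE.
exists (\row_i z i).
  move=> p /PQ Qp'; rewrite evrow; apply: contrapT => /eqP zp.
  apply: Q1; have := QM (meval z p)^-1%:A _ (is_ideal_sub Qid Qp' (evz p)).
  by rewrite opprB addrC subrK mulr_algl scalerA mulVf// scale1r.
apply/eqP; rewrite evrow => fz; apply: Qf.
by have := evz f; rewrite fz scale0r subr0.
Qed.

End Nullstellensatz.

(** * Curves: adjoining an equation makes coordinates algebraic *)
Section PrimeVarieties.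
Variables (R : realType) (n : nat).
Local Notation C := R[i].
Local Notation polyn := (mpoly n C).
Local Notation mX i := (mpolyX C (mnm1 i) : polyn).

Lemma irreducible_zero_set_prime (P : set polyn) :
  is_prime P -> irreducible_variety (zero_set P).
Proof.
move=> Pp; have [Pid P1 PP] := Pp; split; first by exists P.
  by have [z Pz _] := prime_nullstellensatz Pp P1; exists z.
move=> _ _ [S ->] [T ->] ZST; apply: contrapT => /not_orP[nS nT].
have [ZS ZT] : zero_set S `<=` zero_set P /\ zero_set T `<=` zero_set P.
  by rewrite ZST; split=> z ?; [left|right].
have escape U : zero_set P <> zero_set U -> zero_set U `<=` zero_set P ->
    exists2 u, U u & ~ P u.
  move=> nU UP; apply: contrapT => hU; apply: nU; apply/seteqP; split=> // z Pz u Uu.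
  by apply: Pz; apply: contrapT => Pu; apply: hU; exists u.
have [[s Ss Ps] [t Tt Pt]] := (escape S nS ZS, escape T nT ZT).
have [|z Pz] := prime_nullstellensatz (f := s * t) Pp; first by move=> /PP[].
rewrite mevalM mulf_eq0 negb_or => /andP[/eqP sz /eqP tz].
by move: Pz; rewrite ZST => -[/(_ _ Ss)|/(_ _ Tt)].
Qed.

Lemma irreducible_point (z : 'rV[C]_n) : irreducible_variety [set z].
Proof.
pose I := [set p : polyn | meval (z 0) p = 0].
have -> : [set z] = zero_set I.
  apply/seteqP; split=> [_ -> p //|w Iw]; apply/rowP => i.
  have := Iw (mX i - (z 0 i)%:A); rewrite /I /= !mevalB !mevalZ !meval1 !mevalXU !mulr1.
  by move=> /(_ (subrr _))/eqP; rewrite subr_eq0 => /eqP.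
apply: irreducible_zero_set_prime; split; first split.
- exact: meval0.
- by move=> x y; rewrite /I /= mevalD => -> ->; rewrite addr0.
- by move=> a x; rewrite /I /= mevalM => ->; rewrite mulr0.
- by rewrite /I /= meval1; apply/eqP; rewrite oner_eq0.
- by move=> x y; rewrite /I /= mevalM => /eqP; rewrite mulf_eq0 => /orP[] /eqP; [left|right].
Qed.

(** The algebraic form of the hypothesis on the dimension.  If no non-zero
    polynomial in [a] belonged to [P + (f)], some prime [Q] containing [P + (f)]
    would contain no such polynomial either; since [a] is not constant on the
    zero set of [Q], a point of it, that zero set, and the zero set of [P] would
    form a chain of length two. *)
Lemma curve_elimination (P : set polyn) (a f : polyn) :
  is_prime P -> variety_dimension (zero_set P) 1 ->
  (forall l : C, ~ P (a - l%:A)) -> ~ P f ->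
  exists2 r : {poly C}, r != 0 & adjoin P f (horner_alg a r).
Proof.
move=> Pp [_ Pdim] Pa Pf; have [Pid P1 PP] := Pp; apply: contrapT => hr.
have [||x hx [r r0 xr]|Q [Qp IQ QS _]] := @prime_avoiding _ (adjoin P f)
    [set horner_alg a r | r in [set r | r != 0]] (adjoin_ideal f Pid).
- by exists 1; [exact: oner_neq0|exact: rmorph1].
- by move=> _ _ [r r0 <-] [s s0 <-]; exists (r * s); [exact: mulf_neq0|exact: rmorphM].
- by apply: hr; exists r => //; rewrite xr.
have [Qid Q1 _] := Qp.
have PQ : P `<=` Q by move=> p Pp'; apply: IQ; exact: adjoin_sub.
have Qf : Q f by apply: IQ; exact: adjoin_self.
have [z0 Qz0 _] := prime_nullstellensatz Qp Q1.
have Qa : ~ Q (a - (meval (z0 0) a)%:A).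
  move=> /QS; apply; exists ('X - (meval (z0 0) a)%:P); first exact: monic_neq0 (monicXsubC _).
  by rewrite rmorphB /= horner_algX horner_algC.
have ZQP : zero_set Q `<=` zero_set P by move=> z Qz p /PQ /Qz.
suff : has_irreducible_chain (zero_set P) 2 by move=> /Pdim.
exists (fun k => match k with 0%N => [set z0] | 1%N => zero_set Q | _ => zero_set P end).
split=> [[|[|k]] _|[|[|k]]//= _].
- by split; [exact: irreducible_point|move=> _ ->; exact: ZQP].
- by split; first exact: irreducible_zero_set_prime.
- by split; first exact: irreducible_zero_set_prime.
- split; first by move=> _ ->.
  move=> Qz; have [z zQ] := prime_nullstellensatz Qp Qa.
  by rewrite (Qz _ zQ) mevalB mevalZ meval1 mulr1 subrr eqxx.
- split => // PQz; have [z zP] := prime_nullstellensatz Pp Pf.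
  by rewrite (PQz _ zP) ?eqxx.
Qed.

End PrimeVarieties.

(** * Orthogonality and projection in a Hilbert space *)
Lemma exists_invn_lt (R : realType) (e : R) :
  0 < e -> exists N : nat, N.+1%:R^-1 < e.
Proof.
rewrite -invr_gt0 => e0; exists (Num.bound e^-1); rewrite invf_plt ?posrE//.
  by apply: lt_trans (archi_boundP (ltW e0)) _; rewrite ltr_nat.
by rewrite -invr_gt0.
Qed.

Section Hilbert.
Variables (R : realType) (H : completeNormedModType R[i]).
Variable dot : {dot H for (@conjC R[i])}.
Hypothesis dot_norm : forall x : H, dot x x = `|x| ^+ 2.

Lemma dotZl a x y : dot (a *: x) y = a * dot x y.
Proof. exact: linearZl_LR. Qed.

Lemma dotZr a x y : dot x (a *: y) = conjC a * dot x y.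
Proof. exact: linearZr_LR. Qed.

Lemma dotDl x y z : dot (x + y) z = dot x z + dot y z.
Proof. exact: linearDl. Qed.

Lemma dotBl x y z : dot (x - y) z = dot x z - dot y z.
Proof. exact: linearBl. Qed.

Lemma dot_suml (I : Type) (r : seq I) (P : pred I) (F : I -> H) z :
  dot (\sum_(i <- r | P i) F i) z = \sum_(i <- r | P i) dot (F i) z.
Proof.
by apply: (big_morph (dot^~ z)); [move=> x y; exact: dotDl|exact: linear0l].
Qed.

Lemma dotC x y : dot x y = conjC (dot y x).
Proof. by rewrite hermC expr0 mul1r. Qed.

Lemma dot_eq0C x y : dot x y = 0 -> dot y x = 0.
Proof. by rewrite dotC => xy; apply/eqP; rewrite -conjC_eq0 xy. Qed.

(** The norm of a complex Hilbert space takes its values in [R[i]]; the same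
    number in [R] lives in a complete total order. *)
Definition rnorm (x : H) : R := complex.Re `|x|.

Lemma rnormE x : `|x| = (rnorm x)%:C.
Proof. by rewrite /rnorm RRe_real// normr_real. Qed.

Lemma rnorm_ge0 x : 0 <= rnorm x.
Proof. by rewrite -ler0c -rnormE. Qed.

Lemma rnormB x y : rnorm (x - y) = rnorm (y - x).
Proof. by rewrite /rnorm distrC. Qed.

Lemma rnorm_triangle x y z : rnorm (x - z) <= rnorm (x - y) + rnorm (y - z).
Proof. by rewrite -lecR rmorphD /= -!rnormE; exact: ler_distD. Qed.

Lemma rnormZ a x : rnorm (a *: x) = complex.Re `|a| * rnorm x.
Proof.
by apply: (@complexI R); rewrite rmorphM /= -!rnormE normrZ.
Qed.

Lemma rnorm0_eq0 x : (forall e, 0 < e -> rnorm x < e) -> x = 0.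
Proof.
move=> xe; apply/normr0_eq0; rewrite rnormE; congr (_%:C); apply/eqP.
rewrite eq_le rnorm_ge0 andbT; apply/ler_addgt0Pr => e e0.
by rewrite add0r ltW// xe.
Qed.

Lemma dot_rnorm x : dot x x = (rnorm x ^+ 2)%:C.
Proof. by rewrite dot_norm rnormE rmorphXn. Qed.

Lemma rnorm_parallelogram x y :
  rnorm (x - y) ^+ 2 = 2 * rnorm x ^+ 2 + 2 * rnorm y ^+ 2 - rnorm (x + y) ^+ 2.
Proof.
rewrite !mulr_natl; apply: (@complexI R).
rewrite rmorphB rmorphD !rmorphMn /= -!dot_rnorm dnormB dnormD; ring.
Qed.

Lemma complete_rnorm (c : nat -> H) :
  (forall e, 0 < e -> exists M, forall m l, (M <= m)%N -> (M <= l)%N ->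
     rnorm (c m - c l) < e) ->
  exists y, forall e, 0 < e -> exists M, forall m, (M <= m)%N -> rnorm (y - c m) < e.
Proof.
move=> cC.
have /cauchy_cvgP cvc : cauchy (c @ \oo).
  apply/cauchy_ballP => e e0.
  have eE : e = (complex.Re e)%:C by rewrite RRe_real// gtr0_real.
  have [|M hM] := cC (complex.Re e); first by rewrite -ltcR -eE.
  exists ([set x | exists2 m, (M <= m)%N & x = c m], [set x | exists2 m, (M <= m)%N & x = c m]).
    split; exists M => // m /= Mm; by exists m.
  move=> [x y] [[m Mm /= ->] [l Ml ->]].
  by rewrite -ball_normE /ball_ /= rnormE eE ltcR; apply: hM.
exists (lim (c @ \oo)) => e e0.
have /cvgrPdist_lt/(_ e%:C) := cvc; rewrite ltcR => /(_ e0)[M _ hM].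
by exists M => m Mm; have := hM m Mm; rewrite /= rnormE ltcR.
Qed.

Lemma closed_rnorm (K : set H) y : closed K ->
  (forall e, 0 < e -> exists2 k, K k & rnorm (y - k) < e) -> K y.
Proof.
move=> cK hy; apply: cK => B /nbhs_ballP[e /= e0 eB].
have eE : e = (complex.Re e)%:C by rewrite RRe_real// gtr0_real.
have [|k Kk ky] := hy (complex.Re e); first by rewrite -ltcR -eE.
by exists k; split => //; apply: eB; rewrite -ball_normE /ball_ /= rnormE eE ltcR.
Qed.

Lemma rnorm_closed (K : set H) :
  (forall y, (forall e, 0 < e -> exists2 k, K k & rnorm (y - k) < e) -> K y) ->
  closed K.
Proof.
move=> hK y cy; apply: hK => e e0.
have [|k [Kk]] := cy (ball y e%:C); first by apply: nbhsx_ballx; rewrite ltcR.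
by rewrite -ball_normE /ball_ /= rnormE ltcR; exists k.
Qed.

Definition submodule (K : set H) : Prop :=
  K 0 /\ forall a x y, K x -> K y -> K (a *: x + y).

Lemma submoduleD K x y : submodule K -> K x -> K y -> K (x + y).
Proof. by case=> _ hK Kx Ky; rewrite -[x]scale1r; apply: hK. Qed.

Lemma submoduleZ K a x : submodule K -> K x -> K (a *: x).
Proof. by case=> K0 hK Kx; rewrite -[_ *: _]addr0; apply: hK. Qed.

Lemma submoduleB K x y : submodule K -> K x -> K y -> K (x - y).
Proof.
move=> sK Kx Ky; apply: (submoduleD sK) => //.
by rewrite -scaleN1r; apply: submoduleZ.
Qed.

Lemma submodule_sum K (I : Type) (r : seq I) (P : pred I) (F : I -> H) :
  submodule K -> (forall i, P i -> K (F i)) -> K (\sum_(i <- r | P i) F i).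
Proof.
move=> sK hF; apply: big_ind => //; first by case: sK.
by move=> x y; exact: submoduleD.
Qed.

(** The minimum of the norm on the line [u - t v] is reached at [t = 0] only if
    [u] is orthogonal to [v]: test at the coefficient of the projection. *)
Lemma minimal_orthogonal (u v : H) :
  (forall t : R[i], rnorm u <= rnorm (u - t *: v)) -> dot u v = 0.
Proof.
move=> hmin; have [->|v0] := eqVneq v 0; first by rewrite linear0r.
have vv0 : dot v v != 0 by rewrite dnorm_eq0.
set a := dot u v; have /= := hmin (a / dot v v).
rewrite -(@ler_pXn2r _ 2) ?nnegrE ?rnorm_ge0// -lecR -!dot_rnorm dnormB.
have vreal : (dot v v)^*%R = dot v v by rewrite (CrealP _)// ger0_real// dnorm_ge0.
have -> : dot u (a / dot v v *: v) = `|a| ^+ 2 / dot v v.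
  by rewrite dotZr rmorphM /= fmorphV /= vreal -/a normCK mulrC mulrA.
have -> : (`|a| ^+ 2 / dot v v)^*%R = `|a| ^+ 2 / dot v v.
  by rewrite (CrealP _)// ger0_real// divr_ge0 ?exprn_ge0// dnorm_ge0.
rewrite dnormZ normrM normfV (ger0_norm (dnorm_ge0 _ v)).
rewrite -subr_ge0.
have -> : dot u u + (`|a| / dot v v) ^+ 2 * dot v v
     - (`|a| ^+ 2 / dot v v + `|a| ^+ 2 / dot v v) - dot u u = - (`|a| ^+ 2 / dot v v).
  by field.
rewrite oppr_ge0 => le0.
have : `|a| ^+ 2 / dot v v == 0.
  by rewrite eq_le le0 divr_ge0 ?exprn_ge0// dnorm_ge0.
by rewrite mulf_eq0 invr_eq0 (negPf vv0) orbF expf_eq0 normr_eq0 => /eqP.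
Qed.

(** The projection of [y] on the image of [K] under [T].  A minimizing sequence
    [T (c m)] is Cauchy by the parallelogram identity, and [c] is Cauchy with it
    because [T] preserves distances, so that it converges in [K] itself. *)
Lemma isometry_projection (T : H -> H) (K : set H) (y : H) :
  (forall a u v, T (a *: u + v) = a *: T u + T v) -> (forall u, `|T u| = `|u|) ->
  closed K -> submodule K ->
  exists2 c, K c & forall k, K k -> dot (y - T c) (T k) = 0.
Proof.
move=> Tlin Tiso cK sK.
have TB u v : T (u - v) = T u - T v by rewrite addrC -scaleN1r Tlin scaleN1r addrC.
have TD u v : T (u + v) = T u + T v by rewrite -[u]scale1r Tlin !scale1r.
have T0 : T 0 = 0 by rewrite -[0 in LHS](subrr 0) TB subrr.
have TZ a u : T (a *: u) = a *: T u by rewrite -[_ *: u]addr0 Tlin T0 addr0.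
have Trn u : rnorm (T u) = rnorm u by rewrite /rnorm Tiso.
pose D := [set rnorm (y - T k) | k in K]; set d := inf D.
have Dlb : has_lbound D by exists 0 => _ [k _ <-]; exact: rnorm_ge0.
have [K0 _] := sK.
have Dne : D !=set0 by exists (rnorm (y - T 0)); exists 0.
have dle k : K k -> d <= rnorm (y - T k) by move=> Kk; apply: ge_inf => //; exists k.
have d0 : 0 <= d by apply: lb_le_inf => // _ [k _ <-]; exact: rnorm_ge0.
have /choice[c hc] m : exists k, K k /\ rnorm (y - T k) < d + m.+1%:R^-1.
  have [||_ [k Kk <-] hk] := @inf_adherent R D m.+1%:R^-1.
  - by rewrite invr_gt0.
  - by split.
  - by exists k.
have near_min (e : R) k l : 0 < e -> K k -> K l -> rnorm (y - T k) < d + e ->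
    rnorm (y - T l) < d + e -> rnorm (k - l) ^+ 2 < 8 * d * e + 4 * e ^+ 2.
  move=> e0 Kk Kl dk dl.
  have := rnorm_parallelogram (y - T l) (y - T k).
  have -> : y - T l - (y - T k) = T (k - l) by rewrite TB opprB addrC addrA subrK.
  have -> : y - T l + (y - T k) = 2 *: (y - T (2^-1 *: (k + l))).
    rewrite scalerBr TZ scalerA mulfV ?pnatr_eq0// scale1r TD scaler_nat mulr2n.
    by rewrite opprD [- T k - _]addrC addrACA.
  have -> : rnorm (2 *: (y - T (2^-1 *: (k + l)))) = 2 * rnorm (y - T (2^-1 *: (k + l))).
    apply: (@complexI R); rewrite rmorphM /= -!rnormE normrZ; congr (_ * _).
    by rewrite rmorphMn /= rmorph1 gtr0_norm// ltr0n.
  rewrite Trn => ->.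
  have := dle (2^-1 *: (k + l)) (submoduleZ _ sK (submoduleD sK Kk Kl)).
  have := rnorm_ge0 (y - T k); have := rnorm_ge0 (y - T l).
  nra.
have [z hz] : exists z, forall e, 0 < e -> exists M, forall m, (M <= m)%N -> rnorm (z - c m) < e.
  apply: complete_rnorm => e e0.
  (* With e1 <= 1 the bound 8 d e1 + 4 e1^2 of near_min is at most (8 d + 4) e1. *)
  pose e1 := Num.min 1 (e ^+ 2 / (8 * d + 4)).
  have e10 : 0 < e1 by rewrite lt_min ltr01 divr_gt0 ?exprn_gt0//; lra.
  have [M hM] := exists_invn_lt e10.
  exists M => m l Mm Ml.
  have small m' : (M <= m')%N -> rnorm (y - T (c m')) < d + e1.
    move=> Mm'; apply: lt_trans (hc m').2 _; rewrite ltrD2l; apply: le_lt_trans hM.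
    by rewrite lef_pV2 ?posrE// ler_nat.
  have := near_min _ _ _ e10 (hc m).1 (hc l).1 (small _ Mm) (small _ Ml).
  move=> h; rewrite -(@ltr_pXn2r _ 2) ?nnegrE ?rnorm_ge0 ?(ltW e0)//.
  apply: lt_le_trans h _.
  have e11 : e1 <= 1 by rewrite ge_min lexx.
  have e12 : e1 * (8 * d + 4) <= e ^+ 2.
    by rewrite -ler_pdivlMr; [rewrite ge_min lexx orbT|lra].
  nra.
have Kz : K z.
  by apply: closed_rnorm => // e /hz[M hM]; exists (c M); [exact: (hc M).1|exact: hM].
exists z => // k Kk; apply: minimal_orthogonal => t.
have -> : y - T z - t *: T k = y - T (z + t *: k) by rewrite TD TZ opprD addrA.
apply: (@le_trans _ _ d); last by apply: dle; apply: submoduleD => //; exact: submoduleZ.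
apply/ler_addgt0Pr => e e0.
have e20 : 0 < e / 2 by lra.
have [M hM] := hz _ e20; have [N hN] := exists_invn_lt e20.
set m := maxn M N.
apply: le_trans (rnorm_triangle _ (T (c m)) _) _.
have -> : T (c m) - T z = T (c m - z) by rewrite TB.
rewrite Trn (rnormB (c m)).
have le_mN : m.+1%:R^-1 <= N.+1%:R^-1 :> R.
  by rewrite lef_pV2 ?posrE// ler_nat ltnS leq_maxr.
have lt_me := le_lt_trans le_mN hN.
rewrite [e in leRHS]splitr addrA; apply: lerD; last exact/ltW/hM/leq_maxl.
by apply: le_trans (ltW (hc m).2) _; rewrite lerD2l ltW.
Qed.

End Hilbert.

(** * The polynomial calculus of a commuting tuple *)
Section OperatorCalculus.
Variables (R : realType) (H : completeNormedModType R[i]).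
Variables (n : nat) (V : 'I_n -> {linear H -> H}).
Local Notation C := R[i].
Local Notation polyn := (mpoly n C).
Local Notation mX i := (mpolyX C (mnm1 i) : polyn).
Local Notation op := (mpoly_op V).

Lemma mpoly_opE (k : nat) (p : polyn) x : (mmeasure mdeg p <= k)%N ->
  op p x = \sum_(m : bmultinom n k) mcoeff (bmnm m) p *: monomial_op V (bmnm m) x.
Proof.
move=> lt_pk; pose I := bmultinom n k.
rewrite /mpoly_op (big_mksub I) ?msupp_uniq//=; first last.
  by move=> m /msize_mdeg_lt /leq_trans; apply.
by rewrite big_rmcond//= => m; move/memN_msupp_eq0 => ->; rewrite scale0r.
Qed.

Lemma mpoly_opD p q x : op (p + q) x = op p x + op q x.
Proof.
pose k := maxn (mmeasure mdeg (p + q)) (maxn (mmeasure mdeg p) (mmeasure mdeg q)).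
rewrite !(@mpoly_opE k) ?leq_max ?leqnn ?orbT//.
by rewrite -big_split; apply: eq_bigr => m _ /=; rewrite mcoeffD scalerDl.
Qed.

Lemma mpoly_opZ c p x : op (c *: p) x = c *: op p x.
Proof.
pose k := maxn (mmeasure mdeg (c *: p)) (mmeasure mdeg p).
rewrite !(@mpoly_opE k) ?leq_max ?leqnn ?orbT// scaler_sumr.
by apply: eq_bigr => m _ /=; rewrite mcoeffZ scalerA.
Qed.

Lemma mpoly_op_monomial m x : op (mpolyX C m) x = monomial_op V m x.
Proof. by rewrite /mpoly_op msuppX big_seq1 mcoeffX eqxx scale1r. Qed.

Lemma mpoly_op1 x : op 1 x = x.
Proof.
rewrite -mpolyX0 mpoly_op_monomial /monomial_op.
apply: (big_ind (fun f => f x = x)) => [//|f g|i _]; last by rewrite mnmE.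
by move=> fx gx; rewrite /= gx.
Qed.

Lemma mpoly_op0 x : op 0 x = 0.
Proof. by rewrite -(scale0r 1) mpoly_opZ scale0r. Qed.

Lemma mpoly_opB p q x : op (p - q) x = op p x - op q x.
Proof. by rewrite mpoly_opD -scaleN1r mpoly_opZ scaleN1r. Qed.

Lemma mpoly_op_scalar c x : op c%:A x = c *: x.
Proof. by rewrite mpoly_opZ mpoly_op1. Qed.

Lemma mpoly_op_sum (I : Type) (r : seq I) (P : pred I) (F : I -> polyn) x :
  op (\sum_(i <- r | P i) F i) x = \sum_(i <- r | P i) op (F i) x.
Proof.
by apply: (big_morph (fun p => op p x)); [move=> p q; exact: mpoly_opD|exact: mpoly_op0].
Qed.

Hypothesis V_comm : forall i j x, V i (V j x) = V j (V i x).

Lemma monomial_op_mul i m x :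
  monomial_op V (mnm_add (mnm1 i) m) x = V i (monomial_op V m x).
Proof.
have comm_iter j k y : V i (iter k (V j) y) = iter k (V j) (V i y).
  by elim: k => //= k <-; rewrite V_comm.
have iterU j : iter (mnm_add (mnm1 i) m j) (V j) =1
    if i == j then V i \o iter (m j) (V j) else iter (m j) (V j).
  by move=> y; rewrite mnmDE mnm1E; case: eqP => [->|_]; rewrite ?add1n.
rewrite /monomial_op.
have : i \in index_enum 'I_n by rewrite mem_index_enum.
have := index_enum_uniq 'I_n.
elim: (index_enum _) => //= j r IHr /andP[jr /IHr {}IHr].
rewrite !big_cons /= iterU inE; have [ij|_] //= := eqVneq i j; last first.
  by move=> ir; rewrite IHr// comm_iter.
move=> _; congr (V i (iter _ _ _)).
move: jr; rewrite -ij.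
elim: r {IHr} => [|k r IHr]; first by rewrite !big_nil.
rewrite inE negb_or => /andP[ik ir]; rewrite !big_cons /= iterU (negPf ik).
by rewrite IHr.
Qed.

Lemma mpoly_opXM i p x : op (mX i * p) x = V i (op p x).
Proof.
elim/mpolyind: p => [|c m p _ _ IHp]; first by rewrite mulr0 !mpoly_op0 linear0.
rewrite mulrDr !mpoly_opD IHp linearD -scalerAr !mpoly_opZ linearZ /=.
by rewrite -mpolyXD !mpoly_op_monomial monomial_op_mul.
Qed.

Lemma mpoly_opX i x : op (mX i) x = V i x.
Proof. by rewrite -[mX i]mulr1 mpoly_opXM mpoly_op1. Qed.

(** The multiplicativity in [p] reduces to the case of a variable, since the
    polynomials [p] that satisfy it for all [q] form a subalgebra. *)
Lemma mpoly_opM p q x : op (p * q) x = op p (op q x).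
Proof.
elim/mpoly_alg_ind: p q x => [c|i|p p' hp hp'|p p' hp hp'] q x.
- by rewrite mulr_algl mpoly_op_scalar mpoly_opZ.
- by rewrite mpoly_opXM mpoly_opX.
- by rewrite mulrDl !mpoly_opD hp hp'.
- by rewrite -mulrA !hp hp'.
Qed.

Lemma mpoly_op_linear p a x y : op p (a *: x + y) = a *: op p x + op p y.
Proof.
elim/mpoly_alg_ind: p x y => [c|i|p p' hp hp'|p p' hp hp'] x y.
- by rewrite !mpoly_op_scalar scalerDr !scalerA mulrC.
- by rewrite !mpoly_opX linearP.
- by rewrite !mpoly_opD hp hp' scalerDr addrACA.
- by rewrite !mpoly_opM hp' hp.
Qed.

Lemma mpoly_op_vector0 p : op p 0 = 0.
Proof. by have := mpoly_op_linear p (-1) 0 0; rewrite !scaleN1r !addNr. Qed.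

Lemma mpoly_op_invariant (K : set H) p :
  submodule K -> (forall i x, K x -> K (V i x)) -> forall x, K x -> K (op p x).
Proof.
move=> sK KV; elim/mpoly_alg_ind: p => [c|i|p p' hp hp'|p p' hp hp'] x Kx.
- by rewrite mpoly_op_scalar; apply: submoduleZ.
- by rewrite mpoly_opX; apply: KV.
- by rewrite mpoly_opD; apply: submoduleD => //; [exact: hp|exact: hp'].
- by rewrite mpoly_opM; apply: hp; exact: hp'.
Qed.

Lemma Ann_ideal : is_ideal (Ann V).
Proof.
split; first exact: mpoly_op0.
- by move=> p q pA qA x; rewrite mpoly_opD pA qA addr0.
- by move=> a p pA x; rewrite mpoly_opM pA mpoly_op_vector0.
Qed.

Lemma prime_ideal_is_prime : prime_ideal (Ann V) -> is_prime (Ann V).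
Proof.
move=> [[_ /negP A1 _] PP]; split; first exact: Ann_ideal.
  by move=> A1'; apply: A1; apply: mem_set.
move=> x y xy; have := PP x y; rewrite !inE => /(_ xy) /orP[] /set_mem xI; [by left|by right].
Qed.

End OperatorCalculus.

(** * Completely non-unitary tuples: scalars and shifts *)
Section Isometries.
Variables (R : realType) (H : completeNormedModType R[i]).
Variable dot : {dot H for (@conjC R[i])}.
Hypothesis dot_norm : forall x : H, dot x x = `|x| ^+ 2.

(** Polarization: the squared norms of [x + y] and ['i x + y] determine the
    real and imaginary parts of the inner product. *)
Lemma isometry_dot (T : {linear H -> H}) x y :
  isometric T -> dot (T x) (T y) = dot x y.
Proof.
move=> Tiso.
have re_eq u v : dot (T u) (T v) + conjC (dot (T u) (T v)) = dot u v + conjC (dot u v).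
  have : dot (T (u + v)) (T (u + v)) = dot (u + v) (u + v) by rewrite !dot_norm Tiso.
  by rewrite linearD !dnormD !dot_norm !Tiso => /addrI.
have := re_eq x y; have := re_eq ('i%R *: x) y.
have -> : T ('i%R *: x) = 'i%R *: T x by rewrite linearZ.
rewrite !dotZl !rmorphM /= !conjCi !mulNr -!mulrBr.
move=> /(mulfI (neq0Ci _)) h1 h2.
have := congr2 +%R h1 h2; rewrite addrACA [- _ + _]addrC subrr addr0.
rewrite addrACA [- _ + _]addrC subrr addr0 -!mulr2n => /eqP.
by rewrite eqr_pMn2r// => /eqP.
Qed.

Lemma isometric_inj (T : {linear H -> H}) x : isometric T -> T x = 0 -> x = 0.
Proof. by move=> Tiso Tx; apply/normr0_eq0; rewrite -Tiso Tx normr0. Qed.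

Lemma orthocomplement_submodule (S : set H) : submodule (orthocomplement dot S).
Proof.
split=> [y _|a x y hx hy z Sz]; first by rewrite linear0l.
by rewrite dotDl dotZl hx// hy// mulr0 addr0.
Qed.

Lemma isometry_range_closed (T : H -> H) :
  (forall a u v, T (a *: u + v) = a *: T u + T v) -> (forall u, `|T u| = `|u|) ->
  closed (range T).
Proof.
move=> Tlin Tiso; apply: rnorm_closed => y hy.
have [||c _ hc] := isometry_projection dot_norm y Tlin Tiso (K := setT).
- exact: closedT.
- by [].
have TB u v : T (u - v) = T u - T v by rewrite addrC -scaleN1r Tlin scaleN1r addrC.
exists c => //; apply/esym/eqP; rewrite -subr_eq0; apply/eqP; apply: rnorm0_eq0 => e e0.
have [_ [k _ <-] yk] := hy e e0; apply: le_lt_trans yk.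
rewrite -(@ler_pXn2r _ 2) ?nnegrE ?rnorm_ge0// -lecR -!(dot_rnorm dot_norm).
have -> : y - T k = (y - T c) + T (c - k) by rewrite TB addrA subrK.
rewrite [leRHS]hnormDd; last exact: hc.
by rewrite lerDl dnorm_ge0.
Qed.

End Isometries.

Section CompletelyNonUnitary.
Variables (R : realType) (H : completeNormedModType R[i]).
Variable dot : {dot H for (@conjC R[i])}.
Hypothesis dot_norm : forall x : H, dot x x = `|x| ^+ 2.
Variables (n : nat) (V : 'I_n -> {linear H -> H}).
Hypothesis V_iso : commuting_isometries V.
Hypothesis V_cnu : completely_non_unitary dot V.
Local Notation C := R[i].
Local Notation polyn := (mpoly n C).
Local Notation mX i := (mpolyX C (mnm1 i) : polyn).
Local Notation op := (mpoly_op V).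

Let iso i : isometric (V i). Proof. by case: V_iso. Qed.
Let comm i j x : V i (V j x) = V j (V i x). Proof. by case: V_iso => _; apply. Qed.

(** An isometry that maps [K] onto itself maps the orthogonal complement of
    [K] into itself.  Hence a subspace mapped onto itself by every [V i] reduces
    the tuple, which is unitary on it. *)
Lemma cnu_no_unitary_subspace (K : set H) x : closed K -> submodule K ->
  (forall i y, K y -> K (V i y)) -> (forall i y, K y -> exists2 z, K z & y = V i z) ->
  K x -> x = 0.
Proof.
move=> cK sK KV VK Kx; apply: contrapT => x0; apply: V_cnu; exists K.
have VKE i : V i @` K = K.
  by apply/seteqP; split=> [_ [y Ky <-]|y /(VK i)[z Kz ->]]; [exact: KV|exists z].
split=> //.
- case: sK => K0 hK; split; first exact: mem_set.
  by move=> a u v /set_mem Ku /set_mem Kv; apply: mem_set; apply: hK.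
- by move=> K0; move: Kx; rewrite K0.
- move=> i; split; first by rewrite VKE.
  move=> _ [y hy <-] k /(VK i)[z Kz ->].
  by rewrite (isometry_dot dot_norm)//; apply: hy.
- by move=> i; split=> // u v _ _; rewrite (isometry_dot dot_norm).
Qed.

Lemma op_horner_invariant (E : set H) i (r : {poly C}) x : submodule E ->
  (forall y, E y -> E (V i y)) -> E x -> E (op (horner_alg (mX i) r) x).
Proof.
move=> sE EV; elim/poly_ind: r x => [|r c IHr] x Ex.
  by rewrite linear0 mpoly_op0; case: sE.
rewrite rmorphD rmorphM /= horner_algX horner_algC mpoly_opD mpoly_op_scalar.
rewrite mpoly_opM// mpoly_opX//; apply: submoduleD => //; last exact: submoduleZ.
by apply: IHr; apply: EV.
Qed.

(** Factor a power of the variable out of [r], which is harmless as [V i] is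
    injective, and solve the remaining relation for its constant term. *)
Lemma algebraic_vector_preimage i (r : {poly C}) x : r != 0 ->
  op (horner_alg (mX i) r) x = 0 -> exists s, x = V i (op s x).
Proof.
elim/poly_ind: r => [|r c IHr]; first by rewrite eqxx.
rewrite rmorphD rmorphM /= horner_algX horner_algC [_ * mX i]mulrC.
rewrite mpoly_opD mpoly_op_scalar mpoly_opXM//.
have [->|c0] := eqVneq c 0.
  rewrite scale0r !addr0 => rX0 /(isometric_inj (iso i)); apply: IHr.
  by apply: contraNneq rX0 => ->; rewrite mul0r.
move=> _ /eqP; rewrite addr_eq0 => /eqP Vx.
exists (- c^-1 *: horner_alg (mX i) r).
by rewrite mpoly_opZ linearZ /= Vx scaleNr scalerN opprK scalerA mulVf// scale1r.
Qed.

Hypothesis Ann_prime : is_prime (Ann V).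
Hypothesis Z_dim1 : variety_dimension (zero_set (Ann V)) 1.

Definition scalar_coordinate i := exists l : C, Ann V (mX i - l%:A).

Lemma scalar_coordinateP i l : Ann V (mX i - l%:A) <-> forall x, V i x = l *: x.
Proof.
by split=> h x; [have := h x|]; rewrite mpoly_opB mpoly_opX// mpoly_op_scalar ?h ?subrr//;
  move/eqP; rewrite subr_eq0 => /eqP.
Qed.

Lemma eigenvalue_norm i l x : x != 0 -> V i x = l *: x -> `|l| = 1.
Proof.
move=> x0 Vx; have := iso i x; rewrite Vx normrZ -[RHS]mul1r.
by apply: mulIf; rewrite normr_eq0.
Qed.

(** The eigenspace of [V i] is invariant under the tuple.  On it, every
    non-scalar [V j] satisfies a polynomial equation, by elimination modulo
    [X_i - l], and is therefore onto.  So the tuple is unitary there. *)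
Lemma no_eigenvector i l x : ~ scalar_coordinate i -> V i x = l *: x -> x = 0.
Proof.
move=> nsi Vx; have [//|x0] := eqVneq x 0.
have l1 := eigenvalue_norm x0 Vx.
pose K := [set y | V i y = l *: y].
have KV j y : K y -> K (V j y) by move=> Ky; rewrite /K /= comm Ky linearZ.
have sK : submodule K.
  split=> [|a u v Ku Kv]; first by rewrite /K /= linear0 scaler0.
  by rewrite /K /= linearP Ku Kv scalerDr !scalerA mulrC.
apply: (cnu_no_unitary_subspace (K := K)) => //.
- apply: rnorm_closed => y hy; apply/eqP; rewrite -subr_eq0; apply/eqP.
  apply: rnorm0_eq0 => e e0; have [|k Kk yk] := hy (e / 2).
    by rewrite divr_gt0.
  have -> : V i y - l *: y = V i (y - k) - l *: (y - k).
    by rewrite linearB scalerBr Kk opprB addrA subrK.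
  rewrite [e]splitr; apply: le_lt_trans (rnorm_triangle _ 0 _) _.
  rewrite subr0 sub0r; apply: ltrD.
    by rewrite /rnorm iso -/(rnorm _).
  by rewrite /rnorm normrN normrZ l1 mul1r -/(rnorm _).
move=> j y Ky.
have [[m /scalar_coordinateP Vj]|nsj] := pselect (scalar_coordinate j).
  have m0 : m != 0.
    by rewrite -normr_eq0 (eigenvalue_norm x0 (Vj x)) oner_eq0.
  exists (m^-1 *: y); first exact: submoduleZ.
  by rewrite Vj scalerA mulfV// scale1r.
have [||r r0 [h hr]] := curve_elimination (a := mX j) (f := mX i - l%:A) Ann_prime Z_dim1.
- by move=> m hm; apply: nsj; exists m.
- by move=> hm; apply: nsi; exists l.
have [|s ys] := @algebraic_vector_preimage j r y r0.
  have := hr y; rewrite mpoly_opB => /eqP; rewrite subr_eq0 => /eqP ->.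
  rewrite mpoly_opM// mpoly_opB mpoly_opX// mpoly_op_scalar Ky subrr.
  by rewrite mpoly_op_vector0.
exists (op s y) => //; exact: mpoly_op_invariant.
Qed.

Lemma horner_op_injective i (r : {poly C}) x : ~ scalar_coordinate i -> r != 0 ->
  op (horner_alg (mX i) r) x = 0 -> x = 0.
Proof.
move=> nsi r0; have [s] := closed_field_poly_normal r.
move: (lead_coef r) (lead_coef_eq0 r) => c c0 ->; rewrite linearZ /= mulr_algl mpoly_opZ.
move/eqP; rewrite scaler_eq0 c0 (negPf r0) /= => /eqP.
elim: s x => [|l s IHs] x; first by rewrite big_nil rmorph1 mpoly_op1.
rewrite big_cons rmorphM /= mpoly_opM// rmorphB /= horner_algX horner_algC.
rewrite mpoly_opB mpoly_opX// mpoly_op_scalar => /eqP; rewrite subr_eq0 => /eqP.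
by move=> /(no_eigenvector nsi)/IHs.
Qed.

(** Elimination turns a relation [f(V) x = 0] into [r(V_i) x = 0] with [r]
    non-zero, and the linear factors of [r(V_i)] are injective. *)
Lemma op_injective i f x : ~ scalar_coordinate i -> ~ Ann V f -> op f x = 0 -> x = 0.
Proof.
move=> nsi Af fx.
have [|r r0 [h hr]] := curve_elimination (a := mX i) (f := f) Ann_prime Z_dim1 _ Af.
  by move=> m hm; apply: nsi; exists m.
apply: (horner_op_injective nsi r0); have := hr x.
rewrite mpoly_opB mpoly_opM// fx mpoly_op_vector0// subr0; exact.
Qed.

(** Let [K] be the intersection of the ranges of the powers of [V i], on which
    [V i] is unitary.  Elimination modulo [X_j] shows that some non-zero
    [r(V_i)] maps [K] into [V_j K].  The orthogonal complement of [V_j K] in [K]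
    is invariant under [V i], so [r(V_i)] sends it to vectors orthogonal to
    themselves, and the injectivity of [r(V_i)] makes it trivial.  Thus the whole
    tuple is unitary on [K]. *)
Lemma nonscalar_shift i : ~ scalar_coordinate i -> is_shift (V i).
Proof.
move=> nsi; split; first exact: iso.
have iter_lin k a u v : iter k (V i) (a *: u + v) = a *: iter k (V i) u + iter k (V i) v.
  by elim: k => //= k ->; rewrite linearP.
have iter_iso k u : `|iter k (V i) u| = `|u| by elim: k => //= k <-; rewrite iso.
set K := \bigcap_j range (iter j (V i)).
have sK : submodule K.
  split=> [k _|a u v Ku Kv k _]; first by exists 0 => //; elim: k => //= k ->; rewrite linear0.
  have [[u' _ <-] [v' _ <-]] := (Ku k I, Kv k I).
  by exists (a *: u' + v') => //; rewrite iter_lin.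
have cK : closed K.
  apply: closed_bigI => k _.
  exact: (isometry_range_closed dot_norm (iter_lin k) (iter_iso k)).
have KV j y : K y -> K (V j y).
  move=> Ky k _; have [z _ <-] := Ky k I; exists (V j z) => //.
  by elim: k {Ky} => //= k ->; rewrite comm.
have ViK y : K y -> exists2 z, K z & y = V i z.
  move=> Ky; have [z _ zy] := Ky 1%N I; have {}zy : V i z = y by []; exists z => // k _.
  have [w _ wy] := Ky k.+1 I; exists w => //.
  apply/eqP; rewrite -subr_eq0; apply/eqP/(isometric_inj (iso i)).
  by rewrite linearB zy -wy subrr.
apply/seteqP; split=> [x Kx|_ ->]; last by case: sK.
apply: (cnu_no_unitary_subspace (x := x) cK sK KV) => // j y Ky.
have [c Kc cE] := isometry_projection dot_norm y (fun a u v => linearP (V j) a u v) (iso j) cK sK.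
exists c => //; apply/eqP; rewrite -subr_eq0; apply/eqP.
set e := y - V j c in cE *.
have Ke : K e by apply: (submoduleB sK Ky); exact: KV.
have [//|/eqP e0] := pselect (e = 0).
pose E := orthocomplement dot [set V j k | k in K].
have Ee : E e by move=> _ [k Kk <-]; apply: cE.
have EVi z : E z -> E (V i z).
  move=> Ez _ [k /ViK[k' Kk' ->] <-]; rewrite comm (isometry_dot dot_norm)//.
  by apply: Ez; exists k'.
have [||r r0 [h hr]] := curve_elimination (a := mX i) (f := mX j) Ann_prime Z_dim1.
- by move=> m hm; apply: nsi; exists m.
- by move=> /(_ e); rewrite mpoly_opX// => /(isometric_inj (iso j))/eqP; rewrite (negPf e0).
apply: (horner_op_injective nsi r0); apply/eqP; rewrite -(dnorm_eq0 dot); apply/eqP.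
have Er := op_horner_invariant r (orthocomplement_submodule dot _) EVi Ee.
apply: Er; exists (op h e); first exact: (mpoly_op_invariant comm h sK KV Ke).
have := hr e; rewrite mpoly_opB => /eqP; rewrite subr_eq0 => /eqP ->.
by rewrite mulrC mpoly_opXM.
Qed.

End CompletelyNonUnitary.

(** * Wandering subspaces of two commuting isometries *)
Section Wandering.
Variables (R : realType) (H : completeNormedModType R[i]).
Variable dot : {dot H for (@conjC R[i])}.
Hypothesis dot_norm : forall x : H, dot x x = `|x| ^+ 2.
Local Notation C := R[i].

(** The inequality [rnorm w <= rnorm (w - t k)] for all [t] characterizes the
    orthogonality of [w] and [k] and passes to limits in [k]. *)
Lemma orthocomplement_closed (S : set H) : closed (orthocomplement dot S).
Proof.
apply: rnorm_closed => y hy w Sw; apply: dot_eq0C.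
apply: (minimal_orthogonal dot_norm) => t; apply/ler_addgt0Pr => e e0.
set N := complex.Re `|t|.
have N0 : 0 <= N by rewrite -ler0c RRe_real// normr_real.
have [|k hk yk] := hy (e / (N + 1)); first by rewrite divr_gt0// ltr_wpDl.
have le_wk : rnorm w <= rnorm (w - t *: k).
  rewrite -(@ler_pXn2r _ 2) ?nnegrE ?rnorm_ge0// -lecR -!(dot_rnorm dot_norm).
  have wk0 : dot w (t *: k) = 0 by rewrite dotZr (dot_eq0C (hk w Sw)) mulr0.
  by rewrite [leRHS]hnormBd; [rewrite lerDl dnorm_ge0|exact: wk0].
apply: le_trans le_wk (le_trans (rnorm_triangle _ (t *: y) _) _).
rewrite lerD2l -scalerBr rnormZ -/N.
apply: (@le_trans _ _ ((N + 1) * rnorm (y - k))).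
  by rewrite ler_wpM2r ?rnorm_ge0// lerDl.
by rewrite mulrC -ler_pdivlMr ?ltr_wpDl// ltW.
Qed.

Lemma independent_family_bound (E : set H) (I : finType) (phi : I -> H)
    (m : nat) (b : 'I_m -> H) :
  submodule E -> (forall y, E y -> (forall a, dot y (phi a) = 0) -> y = 0) ->
  (forall k, E (b k)) -> (forall c : 'I_m -> C, \sum_k c k *: b k = 0 -> forall k, c k = 0) ->
  (m <= #|I|)%N.
Proof.
move=> sE sep Eb indep; rewrite leqNgt; apply/negP => ltIm.
pose M := \matrix_(k < m, a < #|I|) dot (b k) (phi (enum_val a)).
have /negP : ~ (kermx M == 0).
  rewrite -mxrank_eq0 mxrank_ker subn_eq0 => /leq_trans /(_ (rank_leq_col M)).
  by rewrite leqNgt ltIm.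
move=> /rowV0Pn[c /sub_kermxP cM] /negP; apply; apply/eqP/rowP => k; rewrite mxE.
apply: (indep (c 0)); apply: sep.
  by apply: submodule_sum => // l _; exact: submoduleZ.
move=> a; have /rowP/(_ (enum_rank a)) := cM; rewrite !mxE => cM0; rewrite -[RHS]cM0.
rewrite dot_suml; apply: eq_bigr => l _.
by rewrite dotZl mxE enum_rankK.
Qed.

(** Finitely many functionals that separate the points of [E] bound the size of
    its independent families; one of maximal size spans. *)
Lemma finite_basis (E : set H) (I : finType) (phi : I -> H) :
  submodule E -> (forall y, E y -> (forall a, dot y (phi a) = 0) -> y = 0) ->
  exists (m : nat) (b : 'I_m -> H),
    [/\ forall k, E (b k),
        forall c : 'I_m -> C, \sum_k c k *: b k = 0 -> forall k, c k = 0 &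
        forall y, E y -> exists c : 'I_m -> C, y = \sum_k c k *: b k].
Proof.
move=> sE sep.
pose P m := exists b : 'I_m -> H, (forall k, E (b k)) /\
  (forall c : 'I_m -> C, \sum_k c k *: b k = 0 -> forall k, c k = 0).
have exP : exists m, `[< P m >].
  by exists 0%N; apply/asboolP; exists (fun=> 0); split=> [[]|c _ []].
have leP m : `[< P m >] -> (m <= #|I|)%N.
  by move=> /asboolP[b [Eb indep]]; exact: (independent_family_bound sE sep Eb indep).
have [m /asboolP[b [Eb indep]] mmax] := ex_maxnP exP leP.
exists m, b; split=> // y Ey; apply: contrapT => ny.
suff : (m.+1 <= m)%N by rewrite ltnn.
apply: mmax; apply/asboolP.
exists (fun k => oapp b y (unlift ord0 k)); split.
  by move=> k; case: unliftP => [k' _|_] /=.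
move=> c; rewrite big_ord_recl /= unlift_none /=.
under eq_bigr => k _ do rewrite liftK /=.
move=> c_rel; have [c0|c0] := eqVneq (c ord0) 0.
  move: c_rel; rewrite c0 scale0r add0r => /indep c_lift k.
  by case: (unliftP ord0 k) => [k' ->|->].
exfalso; apply: ny; exists (fun k => - (c ord0)^-1 * c (lift ord0 k)).
move/eqP: c_rel; rewrite addr_eq0 => /eqP c0y.
under eq_bigr => k _ do rewrite -scalerA.
by rewrite -scaler_sumr -[X in _ *: X]opprK -c0y scaleNr scalerN opprK scalerA mulVf// scale1r.
Qed.

Definition wandering (T : {linear H -> H}) (K : set H) : set H :=
  [set y | K y /\ forall k, K k -> dot y (T k) = 0].

Lemma wandering_submodule T K : submodule K -> submodule (wandering T K).
Proof.
move=> sK; split=> [|a u v [Ku hu] [Kv hv]].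
  by split; [case: sK|move=> k _; rewrite linear0l].
split; first by case: sK => _; apply.
by move=> k Kk; rewrite dotDl dotZl hu// hv// mulr0 addr0.
Qed.

Lemma wandering_decomposition (T : {linear H -> H}) K y : isometric T ->
  closed K -> submodule K -> (forall k, K k -> K (T k)) -> K y ->
  exists a c, [/\ wandering T K a, K c & y = a + T c].
Proof.
move=> Tiso cK sK TK Ky.
have [c Kc hc] := isometry_projection dot_norm y (fun a u v => linearP T a u v) Tiso cK sK.
exists (y - T c), c; split=> //; last by rewrite subrK.
by split=> //; apply: (submoduleB sK Ky); exact: TK.
Qed.

(** Between [E], the wandering space of [T], and [F], that of [S], the next two
    lemmas define a linear map from [E + F] to itself, [(e, f) |-> (a, c)] with
    [S e + f = a + T c].  It is a unitary colligation: [f] is orthogonal to [S e]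
    and [a] to [T c], so the squared norms of [e] and [f] add up to
    those of [a] and [c].  The vector [c] lies in [F] because [T c] is the difference
    of two vectors orthogonal to [T S K]. *)
Section Colligation.
Variables (T S : {linear H -> H}) (K : set H).
Hypotheses (Tiso : isometric T) (Siso : isometric S).
Hypothesis TS : forall x, T (S x) = S (T x).
Hypotheses (cK : closed K) (sK : submodule K).
Hypotheses (TK : forall k, K k -> K (T k)) (SK : forall k, K k -> K (S k)).

Lemma colligation_shifted e : wandering T K e ->
  exists a c, [/\ wandering T K a, wandering S K c & S e = a + T c].
Proof.
move=> [Ke he].
have [a [c [wa Kc Se]]] := wandering_decomposition Tiso cK sK TK (SK Ke).
exists a, c; split=> //; split=> // k Kk.
rewrite -(isometry_dot dot_norm c (S k) Tiso).
have -> : T c = S e - a by rewrite Se addrC addKr.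
rewrite dotBl TS (isometry_dot dot_norm)// he// -TS.
by case: wa => _ ->; rewrite ?subrr//; exact: SK.
Qed.

Lemma colligation_plain f : wandering S K f ->
  exists a c, [/\ wandering T K a, wandering S K c & f = a + T c].
Proof.
move=> [Kf hf].
have [a [c [wa Kc fE]]] := wandering_decomposition Tiso cK sK TK Kf.
exists a, c; split=> //; split=> // k Kk.
rewrite -(isometry_dot dot_norm c (S k) Tiso).
have -> : T c = f - a by rewrite fE addrC addKr.
rewrite dotBl TS hf; last exact: TK.
rewrite -TS; case: wa => _ ->; rewrite ?subrr//; exact: SK.
Qed.

End Colligation.
End Wandering.

(** * Cyclic subspaces have finite-dimensional wandering spaces *)
Section Orbit.
Variables (R : realType) (H : completeNormedModType R[i]).
Variable dot : {dot H for (@conjC R[i])}.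
Hypothesis dot_norm : forall x : H, dot x x = `|x| ^+ 2.
Variables (n : nat) (V : 'I_n -> {linear H -> H}).
Hypothesis V_iso : commuting_isometries V.
Local Notation C := R[i].
Local Notation polyn := (mpoly n C).
Local Notation mX i := (mpolyX C (mnm1 i) : polyn).
Local Notation op := (mpoly_op V).

Let iso i : isometric (V i). Proof. by case: V_iso. Qed.
Let comm i j x : V i (V j x) = V j (V i x). Proof. by case: V_iso => _; apply. Qed.

(** The closed subspace generated by the orbit of [x].  As a double orthogonal
    complement it is closed at once, and a vector of it that is orthogonal
    to the orbit is orthogonal to itself. *)
Definition orbit_space (x : H) : set H :=
  orthocomplement dot (orthocomplement dot [set op p x | p in setT]).

Lemma orbit_space_self x : orbit_space x x.
Proof.
by move=> w hw; apply: dot_eq0C; apply: hw; exists 1 => //; exact: mpoly_op1.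
Qed.

(** The vector [c] obtained from the projection of [w] on the range of [V i] plays
    the part of the adjoint of [V i] applied to [w]. *)
Lemma orbit_space_invariant x i y : orbit_space x y -> orbit_space x (V i y).
Proof.
move=> hy w hw.
have [||c _ hc] := isometry_projection dot_norm w (fun a u v => linearP (V i) a u v)
  (iso i) (K := setT); [exact: closedT|by []|].
rewrite -[w](subrK (V i c)) dotC dotDl hc// add0r -dotC (isometry_dot dot_norm)//.
apply: hy => _ [p _ <-]; rewrite -(isometry_dot dot_norm _ _ (iso i)).
have -> : V i c = w - (w - V i c) by rewrite opprB addrC subrK.
rewrite dotBl hc// subr0; apply: hw.
by exists (mX i * p) => //; rewrite mpoly_opXM.
Qed.

Lemma orbit_space_separated x y :
  orbit_space x y -> (forall m, dot y (op (mpolyX C m) x) = 0) -> y = 0.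
Proof.
move=> Ky hy; apply/eqP; rewrite -(dnorm_eq0 dot); apply/eqP; apply: Ky => _ [p _ <-].
elim/mpolyind: p => [|c m p _ _ IHp]; first by rewrite mpoly_op0 linear0r.
by rewrite mpoly_opD mpoly_opZ dotC dotDl dotZl rmorphD rmorphM /= -!dotC hy IHp mulr0 addr0.
Qed.

(** The functional [p |-> <y, p(V) x>] vanishes on the multiples of [X_i], hence
    on those of every [r(X_l)].  Each such relation rewrites a monomial with
    a large exponent in terms of monomials of smaller degree, so the
    functional is determined by its values on a box of exponents. *)
Lemma wandering_separated x i (D : nat) y :
  (forall l, exists r : {poly C}, [/\ r != 0, (size r <= D)%N &
     adjoin (Ann V) (mX i) (horner_alg (mX l) r)]) ->
  wandering dot (V i) (orbit_space x) y ->
  (forall m : multinom n, (forall l, m l < D)%N -> dot y (op (mpolyX C m) x) = 0) ->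
  y = 0.
Proof.
move=> rels [Ky hy] hbox; apply: (orbit_space_separated Ky) => m.
have [d md] := ubnP (mdeg m); elim: d m md => // d IHd m md.
have [/forallP|] := boolP [forall l, (m l < D)%N]; first exact: hbox.
rewrite negb_forall => /existsP[l]; rewrite -leqNgt => Dml.
have [r [r0 rD [h hr]]] := rels l.
have [k rk] : exists k, size r = k.+1.
  by exists (size r).-1; rewrite prednK// size_poly_gt0.
have kml : (k < m l)%N by apply: leq_trans Dml; rewrite -rk.
pose b := mnm_sub m (mnm_muln (mnm1 l) k).
have mE : m = mnm_add b (mnm_muln (mnm1 l) k).
  apply/mnmP => l'; rewrite mnmDE mnmBE mulmnE mnm1E.
  by have [<-|_] := eqVneq l l'; rewrite ?mul1n ?mul0n ?subn0 ?addn0// subnK// ltnW.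
have rE : horner_alg (mX l) r = \sum_(j < k) r`_j *: mX l ^+ j + lead_coef r *: mX l ^+ k.
  rewrite -{1}[r]coefK poly_def rk big_ord_recr linearD linear_sum /=.
  congr (_ + _); last by rewrite linearZ /= mulr_algl rmorphXn /= horner_algX lead_coefE rk.
  by apply: eq_bigr => j _; rewrite linearZ /= mulr_algl rmorphXn /= horner_algX.
have : dot y (op (mpolyX C b * horner_alg (mX l) r) x) = 0.
  have -> : op (mpolyX C b * horner_alg (mX l) r) x = V i (op (mpolyX C b * h) x).
    have := hr x; rewrite mpoly_opB => /eqP; rewrite subr_eq0 => /eqP hx.
    by rewrite mpoly_opM// hx -mpoly_opM// mulrA mulrC mpoly_opXM.
  apply: hy.
  have sO : submodule (orbit_space x) by exact: orthocomplement_submodule.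
  exact: (mpoly_op_invariant comm _ sO (@orbit_space_invariant x) (@orbit_space_self x)).
have monoE j : mpolyX C b * mX l ^+ j = mpolyX C (mnm_add b (mnm_muln (mnm1 l) j)).
  by rewrite mpolyXD mpolyXn.
rewrite rE mulrDr mulr_sumr mpoly_opD mpoly_op_sum -scalerAr monoE -mE mpoly_opZ.
rewrite dotC dotDl dot_suml rmorphD /= [X in conjC X + _ = _]big1; last first.
  move=> j _; rewrite -scalerAr monoE mpoly_opZ dotZl (dot_eq0C (IHd _ _)) ?mulr0//.
  apply: (@leq_trans (mdeg m)); last exact: md.
  rewrite mE !mdegD !mdegMn !mdeg1 !mul1n ltn_add2l.
  exact: ltn_ord.
rewrite rmorph0 add0r dotZl rmorphM /= -dotC => /eqP.
by rewrite mulf_eq0 conjC_eq0 lead_coef_eq0 (negPf r0) => /eqP.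
Qed.

Lemma wandering_basis x i :
  (forall l, exists2 r : {poly C}, r != 0 & adjoin (Ann V) (mX i) (horner_alg (mX l) r)) ->
  exists (m : nat) (b : 'I_m -> H),
    let E := wandering dot (V i) (orbit_space x) in
    [/\ forall k, E (b k),
        forall c : 'I_m -> C, \sum_k c k *: b k = 0 -> forall k, c k = 0 &
        forall y, E y -> exists c : 'I_m -> C, y = \sum_k c k *: b k].
Proof.
move=> rels.
have /choice[r hr] l : exists r : {poly C},
    r != 0 /\ adjoin (Ann V) (mX i) (horner_alg (mX l) r).
  by have [r r0 hr] := rels l; exists r.
pose D := \max_l size (r l).
apply: (@finite_basis _ _ dot _ {ffun 'I_n -> 'I_D}
   (fun a => op (mpolyX C (Multinom [tuple nat_of_ord (a l) | l < n])) x)).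
  apply: wandering_submodule; exact: orthocomplement_submodule.
move=> y Ey hy; apply: (wandering_separated (D := D) _ Ey).
  by move=> l; exists (r l); case: (hr l) => ? ?; split=> //; exact: leq_bigmax.
move=> m mD; have := hy [ffun l => Ordinal (mD l)].
congr (dot y (op (mpolyX C _) x) = 0); apply/mnmP => l.
by rewrite mnmE ffunE.
Qed.

End Orbit.

(** * Two shifts are joined by a toral polynomial *)
Section Determinant.
Variables (R : realType) (H : completeNormedModType R[i]).
Variables (n : nat) (V : 'I_n -> {linear H -> H}).
Hypothesis V_comm : forall i j x, V i (V j x) = V j (V i x).
Local Notation C := R[i].
Local Notation polyn := (mpoly n C).
Local Notation mX i := (mpolyX C (mnm1 i) : polyn).
Local Notation op := (mpoly_op V).

Lemma mpoly_op_vector_sum p (I : Type) (r : seq I) (P : pred I) (F : I -> H) :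
  op p (\sum_(a <- r | P a) F a) = \sum_(a <- r | P a) op p (F a).
Proof.
apply: (big_morph (op p)); last exact: mpoly_op_vector0.
by move=> x y; have := mpoly_op_linear V_comm p 1 x y; rewrite !scale1r.
Qed.

(** Cramer's rule over the ring of polynomials acting on [H]. *)
Lemma det_annihilates d (M : 'M[polyn]_d) (xi : 'I_d -> H) :
  (forall s, \sum_u op (M s u) (xi u) = 0) -> forall u, op (\det M) (xi u) = 0.
Proof.
move=> hM u.
transitivity (\sum_v op ((\adj M *m M) u v) (xi v)).
  rewrite mul_adj_mx (bigD1 u)//= big1 ?addr0 ?mxE ?eqxx ?mulr1n// => v vu.
  by rewrite mxE eq_sym (negPf vu) mulr0n mpoly_op0.
under eq_bigr => v _ do rewrite mxE mpoly_op_sum.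
rewrite exchange_big big1//= => s _.
under eq_bigr => v _ do rewrite mpoly_opM//.
by rewrite -mpoly_op_vector_sum hM mpoly_op_vector0.
Qed.

End Determinant.

Section PairOfShifts.
Variables (R : realType) (H : completeNormedModType R[i]).
Variable dot : {dot H for (@conjC R[i])}.
Hypothesis dot_norm : forall x : H, dot x x = `|x| ^+ 2.
Variables (n : nat) (V : 'I_n -> {linear H -> H}).
Hypothesis V_iso : commuting_isometries V.
Hypothesis V_cnu : completely_non_unitary dot V.
Hypothesis Ann_prime : is_prime (Ann V).
Hypothesis Z_dim1 : variety_dimension (zero_set (Ann V)) 1.
Local Notation C := R[i].
Local Notation polyn := (mpoly n C).
Local Notation mX i := (mpolyX C (mnm1 i) : polyn).
Local Notation op := (mpoly_op V).

Let iso i : isometric (V i). Proof. by case: V_iso. Qed.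
Let comm i j x : V i (V j x) = V j (V i x). Proof. by case: V_iso => _; apply. Qed.

Lemma Ann_nonzero_vector : exists x : H, x != 0.
Proof.
apply: contrapT => hx; have [_ A1 _] := Ann_prime; apply: A1 => x.
by rewrite mpoly_op1; apply: contrapT => /eqP x0; apply: hx; exists x.
Qed.

(** Each coordinate becomes algebraic once [X_i] is set to zero; this is what
    makes the wandering space of [V i] finite-dimensional. *)
Lemma coordinate_relation i l : 
  exists2 r : {poly C}, r != 0 & adjoin (Ann V) (mX i) (horner_alg (mX l) r).
Proof.
have Xi : ~ Ann V (mX i).
  have [x x0] := Ann_nonzero_vector.
  move=> /(_ x); rewrite mpoly_opX// => /(isometric_inj (iso i)).
  by move/eqP; rewrite (negPf x0).
have [[m hm]|nsl] := pselect (scalar_coordinate V l).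
  exists ('X - m%:P); first exact: monic_neq0 (monicXsubC _).
  by exists 0; rewrite mul0r subr0 rmorphB /= horner_algX horner_algC.
by apply: (curve_elimination Ann_prime Z_dim1) => // m hm; apply: nsl; exists m.
Qed.

Lemma side_of_circle (e g : H) (z w : C) : e != 0 -> g != 0 ->
  `|e| ^+ 2 + `|z| ^+ 2 * `|g| ^+ 2 = `|w| ^+ 2 * `|e| ^+ 2 + `|g| ^+ 2 ->
  (`|z| < 1) = (`|w| < 1) /\ (1 < `|z|) = (1 < `|w|).
Proof.
move=> e0 g0 eq.
have e2 : 0 < `|e| ^+ 2 by rewrite exprn_gt0// normr_gt0.
have g2 : 0 < `|g| ^+ 2 by rewrite exprn_gt0// normr_gt0.
have key : (1 - `|z| ^+ 2) * `|g| ^+ 2 = (1 - `|w| ^+ 2) * `|e| ^+ 2.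
  apply/eqP; rewrite -subr_eq0.
  have -> : (1 - `|z| ^+ 2) * `|g| ^+ 2 - (1 - `|w| ^+ 2) * `|e| ^+ 2 =
    (`|w| ^+ 2 * `|e| ^+ 2 + `|g| ^+ 2) - (`|e| ^+ 2 + `|z| ^+ 2 * `|g| ^+ 2) by ring.
  by rewrite eq subrr.
have lt1 (u : C) : (`|u| < 1) = (0 < 1 - `|u| ^+ 2).
  by rewrite subr_gt0 expr_lt1.
have gt1 (u : C) : (1 < `|u|) = (1 - `|u| ^+ 2 < 0).
  by rewrite subr_lt0 expr_gt1.
rewrite !lt1 !gt1 -(pmulr_lgt0 _ g2) key pmulr_lgt0//.
by rewrite -(pmulr_llt0 _ g2) key pmulr_llt0.
Qed.

(** Let [E] and [F] be the wandering spaces of [V i] and [V j] in the cyclic space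
    of a non-zero vector, and write the colligation in bases of [E] and [F].
    Its defining relations say that the matrix [M] of polynomials below
    annihilates the vector of all basis elements.  Hence [det M] annihilates them,
    and it belongs to [Ann V] by injectivity since [E] is not zero.

    A point [z] where [det M] vanishes gives a non-zero row in the kernel, that is
    vectors [e] in [E] and [g] in [F] with
    [V_j e + z_i g = z_j e + V_i g].  Both sides are orthogonal sums, whence
    [|e|^2 + |z_i|^2 |g|^2 = |z_j|^2 |e|^2 + |g|^2]; and neither [e] nor [g] is zero,
    because [V i] and [V j] have no eigenvectors. *)
Lemma shift_pair_toral i j z :
  ~ scalar_coordinate V i -> ~ scalar_coordinate V j -> zero_set (Ann V) z ->
  (`|z 0 i| < 1) = (`|z 0 j| < 1) /\ (1 < `|z 0 i|) = (1 < `|z 0 j|).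
Proof.
move=> nsi nsj Zz; have [x x0] := Ann_nonzero_vector.
pose K := orbit_space dot V x.
have Kx : K x by exact: orbit_space_self.
have sK : submodule K by exact: orthocomplement_submodule.
have cK : closed K by exact: (orthocomplement_closed dot_norm).
have KV l y : K y -> K (V l y) by exact: (orbit_space_invariant dot_norm V_iso).
have [m [b [Eb b_free b_span]]] :=
  wandering_basis dot_norm V_iso x (fun l => coordinate_relation i l).
have [k [f [Ff f_free f_span]]] :=
  wandering_basis dot_norm V_iso x (fun l => coordinate_relation j l).
rewrite -/K in Eb b_span Ff f_span.
have colligation y a c : wandering dot (V i) K a -> wandering dot (V j) K c ->
    y = a + V i c -> exists al : ('I_m -> C) * ('I_k -> C),
    y = \sum_l al.1 l *: b l + V i (\sum_t al.2 t *: f t).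
  by move=> /b_span[al ->] /f_span[ga ->] ->; exists (al, ga).
have /choice[U hU] (s : 'I_m + 'I_k) : exists al : ('I_m -> C) * ('I_k -> C),
    match s with inl l => V j (b l) | inr t => f t end =
    \sum_l al.1 l *: b l + V i (\sum_t al.2 t *: f t).
  case: s => [l|t].
    have [a [c [wa wc]]] := colligation_shifted dot_norm (iso i) (iso j)
      (comm i j) cK sK (KV i) (KV j) (Eb l).
    exact: colligation.
  have [a [c [wa wc]]] := colligation_plain dot_norm (iso i)
      (comm i j) cK sK (KV i) (KV j) (Ff t).
  exact: colligation.
pose xi (u : 'I_(m + k)) := match fintype.split u with inl l => b l | inr t => f t end.
pose M : 'M[polyn]_(m + k) := \matrix_(s, u)
  (match fintype.split s with inl _ => mX j | inr _ => 1 end *+ (s == u) -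
   match fintype.split u with
   | inl l => ((U (fintype.split s)).1 l)%:A
   | inr t => ((U (fintype.split s)).2 t) *: mX i end).
have split_l l : fintype.split (lshift k l) = inl l := unsplitK (inl l).
have split_r t : fintype.split (rshift m t) = inr t := unsplitK (inr t).
have M_rel s : \sum_u op (M s u) (xi u) = 0.
  under eq_bigr => u _ do rewrite mxE mpoly_opB.
  rewrite sumrB (bigD1 s)//= [X in _ + X - _]big1 ?addr0; last first.
    by move=> u us; rewrite eq_sym (negPf us) mulr0n mpoly_op0.
  rewrite eqxx mulr1n big_split_ord /=.
  under eq_bigr => l _ do rewrite /xi split_l mpoly_op_scalar.
  under [X in _ - (_ + X)]eq_bigr => t _ do rewrite /xi split_r mpoly_opZ mpoly_opX//.
  apply/eqP; rewrite subr_eq0; apply/eqP.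
  have := hU (fintype.split s); rewrite linear_sum /=.
  under [X in _ = _ + X -> _]eq_bigr => t _ do rewrite linearZ.
  by move=> <-; rewrite /xi; case: (fintype.split s) => t; rewrite ?mpoly_opX// mpoly_op1.
have det_kill := det_annihilates comm M_rel.
(* If E were zero, V i would map K onto itself, and the shift V i would have a
   non-zero vector in the ranges of all its powers. *)
have m0 : exists l : 'I_m, b l != 0.
  apply: contrapT => b0; move/eqP: x0; apply.
  have E0 y : wandering dot (V i) K y -> y = 0.
    move=> /b_span[c ->]; apply: big1 => l _.
    have [->|bl] := eqVneq (b l) 0; first by rewrite scaler0.
    by exfalso; apply: b0; exists l.
  have Kiter q y : K y -> exists2 c, K c & iter q (V i) c = y.
    elim: q y => [|q IHq] y Ky; first by exists y.
    have [a [c [/E0-> Kc ->]]] :=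
      wandering_decomposition dot_norm (iso i) cK sK (KV i) Ky.
    by have [d Kd <-] := IHq c Kc; exists d => //; rewrite add0r.
  have [_ shift_i] := nonscalar_shift dot_norm V_iso V_cnu Ann_prime Z_dim1 nsi.
  have : [set 0] x; last by [].
  by rewrite -shift_i => q _; have [c _ cx] := Kiter q x Kx; exists c.
have detA : Ann V (\det M).
  apply: contrapT => nA; have [l /eqP] := m0; apply.
  apply: (op_injective dot_norm V_iso V_cnu Ann_prime Z_dim1 nsi nA).
  by have := det_kill (lshift k l); rewrite /xi (unsplitK (inl l)).
have : \det (map_mx (meval (z 0)) M) = 0.
  by rewrite det_map_mx; exact: Zz.
move=> /eqP/det0P[a a0 aM].
(* Evaluated at z, the columns of M express that the colligation maps (e, f) to
   (z_j e, g) with f = z_i g. *)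
pose al l := \sum_s a 0 s * (U (fintype.split s)).1 l.
pose ga t := \sum_s a 0 s * (U (fintype.split s)).2 t.
have column u (N : C) (F : 'I_(m + k) -> C) :
    (forall s, meval (z 0) (M s u) = N *+ (s == u) - F s) ->
    a 0 u * N = \sum_s a 0 s * F s.
  move=> MuE; have /rowP/(_ u) := aM; rewrite !mxE.
  under eq_bigr => s _ do rewrite mxE MuE mulrBr.
  rewrite sumrB (bigD1 u)//= [X in _ + X - _]big1 ?addr0.
    by rewrite eqxx mulr1n => /eqP; rewrite subr_eq0 => /eqP.
  by move=> s su; rewrite (negPf su) mulr0n mulr0.
have a_l l : al l = a 0 (lshift k l) * z 0 j.
  apply/esym/column => s; rewrite mxE split_l mevalB mevalMn mevalZ meval1 mulr1.
  congr (_ - _); have [->|] := eqVneq; last by rewrite !mulr0n.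
  by rewrite split_l mevalXU.
have a_r t : a 0 (rshift m t) = ga t * z 0 i.
  rewrite -[LHS]mulr1 (column _ 1 (fun s => (U (fintype.split s)).2 t * z 0 i)).
    by rewrite mulr_suml; apply: eq_bigr => s _; rewrite mulrA.
  move=> s; rewrite mxE split_r mevalB mevalMn mevalZ mevalXU.
  congr (_ - _); have [->|] := eqVneq; last by rewrite !mulr0n.
  by rewrite split_r meval1.
pose e := \sum_l a 0 (lshift k l) *: b l.
pose g := \sum_t ga t *: f t.
have f_zg : \sum_t a 0 (rshift m t) *: f t = z 0 i *: g.
  by rewrite scaler_sumr; apply: eq_bigr => t _; rewrite a_r scalerA mulrC.
have fundamental : V j e + z 0 i *: g = z 0 j *: e + V i g.
  transitivity (\sum_s a 0 s *: (\sum_l (U (fintype.split s)).1 l *: b l +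
       V i (\sum_t (U (fintype.split s)).2 t *: f t))).
    under eq_bigr => s _ do rewrite -hU.
    rewrite big_split_ord /= -f_zg linear_sum; congr (_ + _); apply: eq_bigr => l _.
      by rewrite split_l linearZ.
    by rewrite split_r.
  under eq_bigr => s _ do rewrite scalerDr.
  rewrite big_split /=; congr (_ + _).
    under eq_bigr => s _ do rewrite scaler_sumr.
    rewrite exchange_big scaler_sumr; apply: eq_bigr => l _ /=.
    rewrite scalerA mulrC -a_l scaler_suml.
    by apply: eq_bigr => s _; rewrite scalerA.
  under eq_bigr => s _ do rewrite -linearZ scaler_sumr /=.
  rewrite -linear_sum; congr (V i _).
  rewrite exchange_big; apply: eq_bigr => t _ /=.
  by rewrite scaler_suml; apply: eq_bigr => s _; rewrite scalerA.
have Ee : wandering dot (V i) K e.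
  by apply: submodule_sum => [|l _]; [|apply: submoduleZ => //]; exact: wandering_submodule.
have Fg : wandering dot (V j) K g.
  by apply: submodule_sum => [|l _]; [|apply: submoduleZ => //]; exact: wandering_submodule.
have not_both : e = 0 -> g = 0 -> False.
  move=> e0 g0; move/eqP: a0; apply; apply/rowP => u; rewrite mxE.
  rewrite -[u]splitK; case: (fintype.split u) => t /=; first exact: b_free e0 t.
  by apply: (f_free (fun t => a 0 (rshift m t))); rewrite f_zg g0 scaler0.
have e_neq0 : e != 0.
  apply/eqP => e0; apply: (not_both e0); move: fundamental.
  rewrite e0 !(linear0, scaler0) !add0r => /esym.
  exact: (no_eigenvector dot_norm V_iso V_cnu Ann_prime Z_dim1 nsi).
have g_neq0 : g != 0.
  apply/eqP => g0; apply: (not_both _ g0); move: fundamental.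
  rewrite g0 !(linear0, scaler0) !addr0.
  exact: (no_eigenvector dot_norm V_iso V_cnu Ann_prime Z_dim1 nsj).
apply: (side_of_circle e_neq0 g_neq0).
have [[Ke he] [Kg hg]] := (Ee, Fg).
have := congr1 (fun y => dot y y) fundamental.
have orth1 : dot (V j e) (z 0 i *: g) = 0.
  by rewrite dotZr (dot_eq0C (hg e Ke)) mulr0.
have orth2 : dot (z 0 j *: e) (V i g) = 0 by rewrite dotZl he// mulr0.
have /= norm1 : dot (V j e + z 0 i *: g) (V j e + z 0 i *: g) =
  dot (V j e) (V j e) + dot (z 0 i *: g) (z 0 i *: g) := hnormDd orth1.
have /= norm2 : dot (z 0 j *: e + V i g) (z 0 j *: e + V i g) =
  dot (z 0 j *: e) (z 0 j *: e) + dot (V i g) (V i g) := hnormDd orth2.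
by rewrite norm1 norm2 !dot_norm !normrZ !iso !exprMn.
Qed.

End PairOfShifts.

(** * Transport of irreducible chains by polynomial maps *)
Section PolynomialMaps.
Variable R : realType.
Local Notation C := R[i].

Definition polynomial_map n k (phi : 'rV[C]_n -> 'rV[C]_k) : Prop :=
  exists q : 'I_k -> mpoly n C, forall z j, phi z 0 j = meval (z 0) (q j).

Lemma variety_preimage n k (phi : 'rV[C]_n -> 'rV[C]_k) X :
  polynomial_map phi -> algebraic_variety X -> algebraic_variety (phi @^-1` X).
Proof.
move=> [q hq] [S ->]; exists [set comp_mpoly [tuple q j | j < k] p | p in S].
have evE (z : 'rV[C]_n) p : meval (z 0) (comp_mpoly [tuple q j | j < k] p) = meval (phi z 0) p.
  by rewrite comp_mpoly_meval; apply: meval_eq => j; rewrite tnth_mktuple hq.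
apply/seteqP; split=> [z Sz _ [p Sp <-]|z Sz p Sp]; first by rewrite evE; exact: Sz.
by rewrite -evE; apply: Sz; exists p.
Qed.

Lemma variety_setI n (X Y : set 'rV[C]_n) :
  algebraic_variety X -> algebraic_variety Y -> algebraic_variety (X `&` Y).
Proof.
move=> [S ->] [T ->]; exists (S `|` T); apply/seteqP; split=> z.
  by move=> [Sz Tz] p [/Sz|/Tz].
by move=> STz; split=> p Sp; apply: STz; [left|right].
Qed.

Lemma irreducible_image n k (phi : 'rV[C]_n -> 'rV[C]_k) Y :
  polynomial_map phi -> irreducible_variety Y -> algebraic_variety (phi @` Y) ->
  irreducible_variety (phi @` Y).
Proof.
move=> phiP [Yvar [y0 Yy0] Yirr] imvar; split=> //; first by exists (phi y0), y0.
move=> A B Avar Bvar YAB.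
have pull D : D `<=` phi @` Y -> Y = Y `&` phi @^-1` D -> phi @` Y = D.
  move=> DY YD; apply/seteqP; split=> // _ [y Yy <-].
  by move: Yy; rewrite YD => -[].
have [AY BY] : A `<=` phi @` Y /\ B `<=` phi @` Y.
  by rewrite YAB; split=> w ?; [left|right].
have [||||] := Yirr (Y `&` phi @^-1` A) (Y `&` phi @^-1` B).
- exact: variety_setI Yvar (variety_preimage phiP Avar).
- exact: variety_setI Yvar (variety_preimage phiP Bvar).
- apply/seteqP; split=> [y Yy|y [] [] //].
  have : (phi @` Y) (phi y) by exists y.
  by rewrite YAB => -[]; [left|right].
- by move=> /(pull A AY); left.
- by move=> /(pull B BY); right.
Qed.

(** Polynomial maps that are inverse to each other between [X] and [W] carry
    subvarieties to subvarieties: the image by [phi] is the preimage by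
    [psi]. *)
Lemma irreducible_chain_transfer n k (X : set 'rV[C]_n) (W : set 'rV[C]_k) phi psi d :
  polynomial_map phi -> polynomial_map psi -> algebraic_variety W ->
  (forall z, X z -> W (phi z) /\ psi (phi z) = z) ->
  (forall w, W w -> X (psi w) /\ phi (psi w) = w) ->
  has_irreducible_chain X d -> has_irreducible_chain W d.
Proof.
move=> phiP psiP Wvar XW WX [Y [Yirr Yprop]].
have imE D : D `<=` X -> phi @` D = W `&` psi @^-1` D.
  move=> DX; apply/seteqP; split=> [_ [y Dy <-]|w [Ww Dw]].
    by have [? phiK] := XW _ (DX _ Dy); split=> //; rewrite /= phiK.
  by exists (psi w) => //; have [] := WX _ Ww.
exists (fun j => phi @` Y j); split=> j jd.
  have [[Yvar Yne Yi] YX] := Yirr j jd; split.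
    apply: irreducible_image => //; rewrite imE//.
    exact: variety_setI Wvar (variety_preimage psiP Yvar).
  by move=> _ [y Yy <-]; have [] := XW _ (YX _ Yy).
have [_ YX] := Yirr j (ltnW jd); have [_ YX'] := Yirr j.+1 jd.
have [Ysub nYsub] := Yprop j jd; split.
  by move=> _ [y Yy <-]; exists y => //; exact: Ysub.
move=> himg; apply: nYsub => y Yy.
have [|y' Yy' /(congr1 psi)] := himg (phi y); first by exists y.
have [_ ->] := XW _ (YX _ Yy'); have [_ ->] := XW _ (YX' _ Yy).
by move=> <-.
Qed.

Lemma variety_dimension_transfer n k (X : set 'rV[C]_n) (W : set 'rV[C]_k) phi psi d :
  polynomial_map phi -> polynomial_map psi ->
  algebraic_variety X -> algebraic_variety W ->
  (forall z, X z -> W (phi z) /\ psi (phi z) = z) ->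
  (forall w, W w -> X (psi w) /\ phi (psi w) = w) ->
  variety_dimension X d -> variety_dimension W d.
Proof.
move=> phiP psiP Xvar Wvar XW WX [Xd Xmax]; split.
  exact: (irreducible_chain_transfer phiP psiP Wvar XW WX Xd).
move=> l Wl; apply: Xmax; exact: (irreducible_chain_transfer psiP phiP Xvar WX XW Wl).
Qed.

Lemma cylinder_structure s t (sigma : 'S_(s + t)) (lam : 'rV[C]_t)
    (X : set 'rV[C]_(s + t)) d :
  algebraic_variety X ->
  (forall z, X z -> forall j, z 0 (sigma (rshift s j)) = lam 0 j) ->
  variety_dimension X d ->
  exists W : set 'rV[C]_s,
    [/\ algebraic_variety W,
        forall w, W w -> exists2 z, X z & forall a, w 0 a = z 0 (sigma (lshift t a)),
        variety_dimension W d &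
        col_perm sigma @` X = (fun w => row_mx w lam) @` W].
Proof.
move=> Xvar Xlam Xd.
pose psi (w : 'rV[C]_s) : 'rV[C]_(s + t) := col_perm (sigma^-1)%g (row_mx w lam).
pose phi (z : 'rV[C]_(s + t)) : 'rV[C]_s := lsubmx (col_perm sigma z).
have psiE w u : psi w 0 (sigma u) = row_mx w lam 0 u by rewrite mxE permK.
have phiE z a : phi z 0 a = z 0 (sigma (lshift t a)) by rewrite !mxE.
have phiK z : X z -> psi (phi z) = z.
  move=> Xz; apply/rowP => k; rewrite -[k](permKV sigma) psiE.
  case: (split_ordP ((sigma^-1)%g k)) => u ->; rewrite ?row_mxEl ?row_mxEr.
    by rewrite phiE.
  by rewrite Xlam.
have psiK w : phi (psi w) = w.
  by apply/rowP => a; rewrite phiE psiE row_mxEl.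
have phiP : polynomial_map phi.
  by exists (fun a => mpolyX C (mnm1 (sigma (lshift t a)))) => z a; rewrite phiE mevalXU.
have psiP : polynomial_map psi.
  exists (fun k => match fintype.split ((sigma^-1)%g k) with
    | inl a => mpolyX C (mnm1 a) | inr b => (lam 0 b)%:A end) => w k.
  rewrite -[k](permKV sigma) psiE permK [LHS]mxE.
  by case: fintype.split => u; rewrite ?mevalXU// mevalZ meval1 mulr1.
exists (psi @^-1` X); split.
- exact: variety_preimage.
- by move=> w Xw; exists (psi w) => // a; rewrite psiE row_mxEl.
- apply: (variety_dimension_transfer phiP psiP Xvar _ _ _ Xd).
  + exact: variety_preimage.
  + by move=> z Xz; rewrite /= phiK.
  + by move=> w Xw; rewrite psiK.
- have permK' w : col_perm sigma (psi w) = row_mx w lam.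
    by apply/rowP => k; rewrite [LHS]mxE psiE.
  apply/seteqP; split=> [_ [z Xz <-]|_ [w Xw <-]].
    by exists (phi z); rewrite /= ?phiK// -permK' phiK.
  by exists (psi w).
Qed.

End PolynomialMaps.

(** * Structure of the tuple and of its variety *)
Theorem theorem4p4 (R : realType) (H : completeNormedModType R[i])
    (dot : {dot H for (@conjC R[i])})
    (dot_norm : forall x : H, dot x x = `|x| ^+ 2)
    (n : nat) (V : 'I_n -> {linear H -> H})
    (V_iso : commuting_isometries V)
    (V_cnu : completely_non_unitary dot V)
    (Ann_prime : prime_ideal (Ann V))
    (Z_dim1 : variety_dimension (zero_set (Ann V)) 1) :
  exists (s t : nat) (e : (s + t)%N = n) (sigma : 'S_n) (lam : 'rV[R[i]]_t),
    [/\ (0 < s)%N,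
        [/\ forall i : 'I_s, is_shift (V (sigma (cast_ord e (lshift t i)))),
            forall (j : 'I_t) (x : H),
              V (sigma (cast_ord e (rshift s j))) x = lam 0 j *: x &
            forall j : 'I_t, `|lam 0 j| = 1] &
        exists W : set 'rV[R[i]]_s,
          [/\ distinguished_variety W, variety_dimension W 1 &
              col_perm sigma @` zero_set (Ann V) =
              (fun w => castmx (erefl 1%N, e) (row_mx w lam)) @` W]].
Proof.
have [_ comm] := V_iso.
have {}Ann_prime : is_prime (Ann V) by exact: prime_ideal_is_prime.
have [x x0] := Ann_nonzero_vector Ann_prime.
pose A : pred 'I_n := fun i => ~~ `[< scalar_coordinate V i >].
have [s [t [e [sigma [sigma_l sigma_r]]]]] : exists (s t : nat) (e : (s + t)%N = n) (sigma : 'S_n),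
    (forall i : 'I_s, A (sigma (cast_ord e (lshift t i)))) /\
    (forall j : 'I_t, ~~ A (sigma (cast_ord e (rshift s j)))).
  exists #|A|, #|predC A|.
  have e : (#|A| + #|predC A|)%N = n by rewrite cardC card_ord.
  exists e.
  pose g u := match fintype.split u with
    | inl a => enum_val (A := A) a | inr b => enum_val (A := predC A) b end.
  have g_inj : injective g.
    move=> u v; rewrite /g -[u]splitK -[v]splitK !unsplitK.
    case: (fintype.split u) (fintype.split v) => [a|b] [a'|b'].
    - by move=> /enum_val_inj->.
    - have Aa : A (enum_val (A := A) a) := enum_valP a.
      have /negP Ab : ~~ A (enum_val (A := predC A) b') := enum_valP b'.
      by move=> ab; exfalso; apply: Ab; rewrite -ab.
    - have Aa : A (enum_val (A := A) a') := enum_valP a'.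
      have /negP Ab : ~~ A (enum_val (A := predC A) b) := enum_valP b.
      by move=> ab; exfalso; apply: Ab; rewrite ab.
    - by move=> /enum_val_inj->.
  have gc_inj : injective (fun k => g (cast_ord (esym e) k)).
    by move=> u v /g_inj/cast_ord_inj.
  exists (perm gc_inj); split=> u; rewrite permE cast_ordK /g.
    by rewrite (unsplitK (inl u)); exact: (enum_valP u).
  by rewrite (unsplitK (inr u)); exact: (enum_valP u).
have /choice[l hl] i : exists l : R[i], ~~ A i -> forall y, V i y = l *: y.
  have [[l hl]|ns] := pselect (scalar_coordinate V i); last first.
    by exists 0; rewrite negbK => /asboolP.
  by exists l => _; apply/scalar_coordinateP.
have l1 i : ~~ A i -> `|l i| = 1 by move=> /hl Vi; exact: (eigenvalue_norm V_iso x0 (Vi x)).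
exists s, t, e, sigma, (\row_j l (sigma (cast_ord e (rshift s j)))).
have nonscalar i : ~ scalar_coordinate V (sigma (cast_ord e (lshift t i))).
  by have := sigma_l i; move/asboolPn.
have s0 : (0 < s)%N.
  rewrite lt0n; apply/eqP => s0; move/eqP: x0; apply.
  have allscal i : ~~ A i.
    have -> : i = sigma (cast_ord e (cast_ord (esym e) ((sigma^-1)%g i))).
      by rewrite cast_ordKV permKV.
    case: (split_ordP (cast_ord (esym e) ((sigma^-1)%g i))) => u ->; last exact: sigma_r.
    by exfalso; case: u => u; rewrite s0.
  apply: (cnu_no_unitary_subspace dot_norm V_iso V_cnu (K := setT)) => //.
  move=> i y _; exists ((l i)^-1 *: y) => //; rewrite hl// scalerA mulfV ?scale1r//.
  by rewrite -normr_eq0 l1// oner_eq0.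
split=> //.
- split=> [i|j y|j]; rewrite ?mxE; last exact/l1/sigma_r.
    exact: (nonscalar_shift dot_norm V_iso V_cnu Ann_prime Z_dim1).
  exact/hl/sigma_r.
set lam := \row_j _.
have Zlam z : zero_set (Ann V) z ->
    forall j, z 0 (sigma (cast_ord e (rshift s j))) = lam 0 j.
  move=> Zz j; have /(scalar_coordinateP V_iso) Aj := hl _ (sigma_r j).
  have := Zz _ Aj; rewrite mevalB mevalXU mevalZ meval1 mulr1 mxE => /eqP.
  by rewrite subr_eq0 => /eqP.
have toral i j z : zero_set (Ann V) z ->
  let zi := z 0 (sigma (cast_ord e (lshift t i))) in
  let zj := z 0 (sigma (cast_ord e (lshift t j))) in
  (`|zi| < 1) = (`|zj| < 1) /\ (1 < `|zi|) = (1 < `|zj|).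
  move=> Zz; exact: (shift_pair_toral dot_norm V_iso V_cnu Ann_prime Z_dim1).
have Zvar : algebraic_variety (zero_set (Ann V)) by exists (Ann V).
move: (zero_set (Ann V)) Zvar Z_dim1 Zlam toral => X Xvar Xdim Xlam toral.
clearbody lam; clear - s0 Xvar Xdim Xlam toral.
(* From here on the number of coordinates can be replaced by s + t, which removes
   the casts. *)
case: n / e sigma lam X Xvar Xdim Xlam toral => sigma lam X Xvar Xdim Xlam toral.
have [|W [Wvar WX Wdim WE]] := cylinder_structure Xvar _ Xdim (sigma := sigma) (lam := lam).
  by move=> z Xz j; rewrite -(Xlam z Xz) cast_ord_id.
exists W; split=> //.
split=> // w /WX[z Xz wz].
have wtoral i j : (`|w 0 i| < 1) = (`|w 0 j| < 1) /\ (1 < `|w 0 i|) = (1 < `|w 0 j|).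
  by have := toral i j z Xz; rewrite !cast_ord_id -!wz.
pose i0 := Ordinal s0.
have : [|| `|w 0 i0| < 1, `|w 0 i0| == 1 | 1 < `|w 0 i0|].
  by case: (real_ltgtP (normr_real (w 0 i0)) (@real1 _)) => //.
case/or3P => h.
- by left; left => i; rewrite (wtoral i i0).1.
- left; right => i; apply/eqP.
  have := wtoral i i0; rewrite (eqP h) ltxx => -[].
  by case: (real_ltgtP (normr_real (w 0 i)) (@real1 _)).
- by right => i; rewrite (wtoral i i0).2.
Qed.
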